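(* Let $n\ge 0$ be an integer and $w\in\mathbb{C}$ with $\Re w>0$. The General Stirling-Ramanujan constant $\mathbf{S}_n(w)$ is an exponential period over the field $\mathbb{Q}(t,e^{-t},w,e^{-wt})$.
   Context: Logarithms are principal branches. For an integer $n\ge 0$ and $\Re w>0$, the partial sum $\sum_{k=0}^{s-1}(k+w)^n\log(k+w)$ has, as the integer $s\to+\infty$, a unique asymptotic expansion in the family of functions $s^m\log s$ ($m\ge 0$) and $s^m$ ($m\in\mathbb{Z}$); $\mathbf{S}_n(w)$ is its constant term (coefficient of $s^0$). Here $w$ is a fixed complex number, $t$ is the variable, and $\mathbb{Q}(t,e^{-t},w,e^{-wt})$ is the field of meromorphic functions of $t$ generated over $\mathbb{Q}$ by $t$, $e^{-t}$, the constant $w$ and $e^{-wt}$. A complex number is an exponential period over a field $\mathbb{F}$ of meromorphic functions of $t$ if it equals a convergent integral $\int_0^{+\infty}f(t)\,dt$ with $f\in\mathbb{F}$. *)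

(* Defs.v *)
From Stdlib Require Export Reals ZArith QArith Qreals ClassicalEpsilon.
From Coquelicot Require Export Coquelicot.
Open Scope R_scope.

Definition Cexp (z : C) : C := (exp (Re z) * cos (Im z), exp (Re z) * sin (Im z)).

(* For [z <> 0], the argument of [z] in ]-PI, PI]. *)
Definition Arg (z : C) : R :=
  if Rle_dec 0 (Im z) then acos (Re z / Cmod z) else - acos (Re z / Cmod z).

(* Principal branch of the logarithm, for [z <> 0]. *)
Definition Clog (z : C) : C := (ln (Cmod z), Arg z).

(* The sum over [0 <= k < s]. [sum_n] includes its upper index, hence the
   predecessor; the value at [s = 0] is irrelevant for asymptotics. *)
Definition partial_sum (n : nat) (w : C) (s : nat) : C :=
  sum_n (fun k : nat =>
    Cmult (Cpow (Cplus (RtoC (INR k)) w) n) (Clog (Cplus (RtoC (INR k)) w)))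
    (pred s).

(* Truncation at order [s ^ (-N)] of the formal expansion
     sum_(0 <= m <= M) a_m s^m log s + sum_(m <= M) b_m s^m,
   with [m] running over Z in the second sum. *)
Definition expansion (M : nat) (a : nat -> C) (b : Z -> C) (N s : nat) : C :=
  Cplus
    (sum_n (fun m : nat => Cmult (a m) (RtoC (INR s ^ m * ln (INR s)))) M)
    (sum_n (fun i : nat =>
       let m := (Z.of_nat i - Z.of_nat N)%Z in
       Cmult (b m) (RtoC (powerRZ (INR s) m))) (M + N)).

Definition has_expansion (u : nat -> C) (M : nat) (a : nat -> C) (b : Z -> C) : Prop :=
  forall N : nat,
    is_lim_seq
      (fun s : nat => Cmod (Cminus (u s) (expansion M a b N s)) * INR s ^ N) 0.

Definition is_constant_term (u : nat -> C) (c : C) : Prop :=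
  exists (M : nat) (a : nat -> C) (b : Z -> C), has_expansion u M a b /\ c = b 0%Z.

(* [epsilon] selects the constant term, whose value is meaningful because the
   expansion exists and is unique when [0 < Re w]. *)
Definition stirling_ramanujan (n : nat) (w : C) : C :=
  epsilon (inhabits (RtoC 0)) (is_constant_term (partial_sum n w)).

(* A meromorphic function is represented by any total function that agrees with
   it off a closed discrete set; [mero_eq] is equality of the represented
   functions. *)
Definition mero_eq (f g : C -> C) : Prop :=
  forall z : C, locally' z (fun x : C => f x = g x).

(* The field of meromorphic functions generated over Q by [G]. The values that
   [Cinv] takes at the zeros of [f] are irrelevant by [generated_eq]. *)
Inductive generated_field (G : (C -> C) -> Prop) : (C -> C) -> Prop :=
| generated_rat (q : Q) : generated_field G (fun _ => RtoC (Q2R q))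
| generated_gen (f : C -> C) : G f -> generated_field G f
| generated_add (f g : C -> C) :
    generated_field G f -> generated_field G g ->
    generated_field G (fun t => Cplus (f t) (g t))
| generated_opp (f : C -> C) :
    generated_field G f -> generated_field G (fun t => Copp (f t))
| generated_mul (f g : C -> C) :
    generated_field G f -> generated_field G g ->
    generated_field G (fun t => Cmult (f t) (g t))
| generated_inv (f : C -> C) :
    generated_field G f -> ~ mero_eq f (fun _ => RtoC 0) ->
    generated_field G (fun t => Cinv (f t))
| generated_eq (f g : C -> C) :
    generated_field G f -> mero_eq f g -> generated_field G g.

Inductive exp_generators (w : C) : (C -> C) -> Prop :=
| gen_t : exp_generators w (fun t => t)
| gen_exp : exp_generators w (fun t => Cexp (Copp t))
| gen_w : exp_generators w (fun _ => w)
| gen_exp_w : exp_generators w (fun t => Cexp (Copp (Cmult w t))).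

(* Convergence is that of an improper Riemann integral at both endpoints. *)
Definition exponential_period (F : (C -> C) -> Prop) (x : C) : Prop :=
  exists f : C -> C, F f /\
    is_RInt_gen (V := C_R_NormedModule) (fun t : R => f (RtoC t))
      (at_right 0) (Rbar_locally p_infty) x.

(* Main.v *)
Require Import Defs.
From Stdlib Require Import Lra Lia ssreflect.

(* For [0 < Re z] and [h_n] the n-th harmonic number, iterated integration by
   parts from Frullani's formula gives
     int_0^oo t^(-n-1) (e^(-zt) - sum_(j<n) (-zt)^j/j! - (-zt)^n/n! e^(-t)) dt
       = (-z)^n/n! (h_n - log z).
   Let [c_k] be the Taylor coefficients of [t e^(-wt)/(1 - e^(-t))] at 0. Summing
   over [z = w, ..., w + s - 1] telescopes the integrand, so that the partial sum is,
   up to the factor [(-1)^n n!] and a polynomial in [s] without constant term,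
   minus the integral [I] of
     t^(-n-2) (t e^(-wt)/(1 - e^(-t)) - sum_(k<=n) c_k t^k - c_(n+1) t^(n+1) e^(-t)),
   plus the same integral with [w + s] in place of [w]. Writing the latter as a
   combination of the integrals above at [z = s] and of a Laplace transform, its
   expansion consists of terms [s^m log s], of [s^m] with [m > 0] and of negative
   powers of [s]. Hence the constant is [- (-1)^n n! I]. *)

(** The factor [e^(-t)] in the top term is forced: a bare Taylor quotient that is integrable at 0 in
    general decays only like [1/t] at infinity, and a cut-off at [t = 1] would leave the field of
    integrands.

    At [w + s] only [e^(-st)] is treated as the exponential; the generating function with parameter
    [w] acts as a bounded amplitude. The logarithms and powers that appear are then those of the
    real number [s], and no expansion in [s + w] has to be converted.

    Frullani's formula is needed at complex [z]. It comes from differentiating along the segment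
    from 1 to [z], with second-order estimates under the integral, so that everything remains
    calculus in one real variable.

    Coefficient identities for the generating function are not computed: two asymptotic series of
    the same function at [0+] coincide.

    Since [stirling_ramanujan] is chosen by [epsilon], exhibiting one expansion does not identify
    it. A separate argument shows that the constant term is unique, and for this the truncations at
    order 0 suffice. *)

Ltac Rring :=
  match goal with |- ?a = ?b => change (@eq R a b) end;
  repeat (progress (unfold plus, minus, opp, scal, mult, one, zero; cbn));
  unfold Cmult, Cplus, Copp, Cminus, Ci, RtoC, Re, Im; cbn; ring.

Lemma C_ext (x y : C) : Re x = Re y -> Im x = Im y -> x = y.
Proof. destruct x, y; simpl; intros -> ->; reflexivity. Qed.

(** * Componentwise calculus for complex functions of a real variable *)

(** Stated on components so that the real rules and [auto_derive] apply; [Cderiv_is_derive] returns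
    to the normed space [C]. *)
Definition Cderiv (f : R -> C) (t : R) (l : C) : Prop :=
  is_derive (fun u => Re (f u)) t (Re l) /\ is_derive (fun u => Im (f u)) t (Im l).

Definition Ccont (f : R -> C) (t : R) : Prop :=
  continuous (fun u => Re (f u)) t /\ continuous (fun u => Im (f u)) t.

Lemma Cderiv_ext_loc (f g : R -> C) (t : R) (l : C) :
  locally t (fun u => f u = g u) -> Cderiv f t l -> Cderiv g t l.
Proof.
  intros H [H1 H2]; split.
  - apply is_derive_ext_loc with (2 := H1). revert H; apply filter_imp; intros u ->; reflexivity.
  - apply is_derive_ext_loc with (2 := H2). revert H; apply filter_imp; intros u ->; reflexivity.
Qed.

Lemma Cderiv_eq (f : R -> C) (t : R) (l l' : C) : Cderiv f t l -> l = l' -> Cderiv f t l'.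
Proof. intros H <-; exact H. Qed.

Lemma Cderiv_const (c : C) (t : R) : Cderiv (fun _ => c) t (RtoC 0).
Proof.
  split.
  - apply (is_derive_const (K := R_AbsRing) (V := R_NormedModule) (Re c) t).
  - apply (is_derive_const (K := R_AbsRing) (V := R_NormedModule) (Im c) t).
Qed.

Lemma Cderiv_RtoC (f : R -> R) (t l : R) :
  is_derive f t l -> Cderiv (fun u => RtoC (f u)) t (RtoC l).
Proof.
  intros H; split; [exact H|].
  apply (is_derive_const (K := R_AbsRing) (V := R_NormedModule) 0 t).
Qed.

Lemma Cderiv_plus (f g : R -> C) (t : R) (l m : C) :
  Cderiv f t l -> Cderiv g t m -> Cderiv (fun u => Cplus (f u) (g u)) t (Cplus l m).
Proof.
  intros [H1 H2] [H3 H4]; split.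
  - apply: (is_derive_plus _ _ _ _ _ H1 H3).
  - apply: (is_derive_plus _ _ _ _ _ H2 H4).
Qed.

Lemma Cderiv_opp (f : R -> C) (t : R) (l : C) :
  Cderiv f t l -> Cderiv (fun u => Copp (f u)) t (Copp l).
Proof.
  intros [H1 H2]; split.
  - apply: (is_derive_opp _ _ _ H1).
  - apply: (is_derive_opp _ _ _ H2).
Qed.

Lemma Cderiv_minus (f g : R -> C) (t : R) (l m : C) :
  Cderiv f t l -> Cderiv g t m -> Cderiv (fun u => Cminus (f u) (g u)) t (Cminus l m).
Proof. intros H1 H2; apply Cderiv_plus; [|apply Cderiv_opp]; assumption. Qed.

Lemma is_derive_Rmult (f g : R -> R) (t l m : R) :
  is_derive f t l -> is_derive g t m ->
  is_derive (fun u => f u * g u) t (l * g t + f t * m).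
Proof. intros H1 H2; apply: (is_derive_mult _ _ _ _ _ H1 H2); intros; apply Rmult_comm. Qed.

Lemma Cderiv_mult (f g : R -> C) (t : R) (l m : C) :
  Cderiv f t l -> Cderiv g t m ->
  Cderiv (fun u => Cmult (f u) (g u)) t (Cplus (Cmult l (g t)) (Cmult (f t) m)).
Proof.
  intros [H1 H2] [H3 H4]; split; simpl.
  - evar_last.
    + apply: is_derive_minus; apply is_derive_Rmult; eassumption.
    + Rring.
  - evar_last.
    + apply: is_derive_plus; apply is_derive_Rmult; eassumption.
    + Rring.
Qed.

Lemma Cderiv_scal (k : C) (f : R -> C) (t : R) (l : C) :
  Cderiv f t l -> Cderiv (fun u => Cmult k (f u)) t (Cmult k l).
Proof.
  intros H; apply Cderiv_eq with (1 := Cderiv_mult _ _ _ _ _ (Cderiv_const k t) H); ring.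
Qed.

Lemma Cderiv_cont (f : R -> C) (t : R) (l : C) : Cderiv f t l -> Ccont f t.
Proof.
  intros [H1 H2]; split; apply: ex_derive_continuous; eexists; eassumption.
Qed.

Lemma Ccont_ext_loc (f g : R -> C) (t : R) :
  locally t (fun u => f u = g u) -> Ccont f t -> Ccont g t.
Proof.
  intros H [H1 H2]; split.
  - apply continuous_ext_loc with (2 := H1). revert H; apply filter_imp; intros u ->; reflexivity.
  - apply continuous_ext_loc with (2 := H2). revert H; apply filter_imp; intros u ->; reflexivity.
Qed.

Lemma Ccont_const (c : C) (t : R) : Ccont (fun _ => c) t.
Proof. split; apply continuous_const. Qed.

Lemma Ccont_RtoC (f : R -> R) (t : R) : continuous f t -> Ccont (fun u => RtoC (f u)) t.
Proof. intros H; split; [exact H | apply continuous_const]. Qed.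

Lemma Ccont_plus (f g : R -> C) (t : R) :
  Ccont f t -> Ccont g t -> Ccont (fun u => Cplus (f u) (g u)) t.
Proof.
  intros [H1 H2] [H3 H4]; split.
  - apply: (continuous_plus _ _ _ H1 H3).
  - apply: (continuous_plus _ _ _ H2 H4).
Qed.

Lemma Ccont_opp (f : R -> C) (t : R) : Ccont f t -> Ccont (fun u => Copp (f u)) t.
Proof.
  intros [H1 H2]; split.
  - apply: (continuous_opp _ _ H1).
  - apply: (continuous_opp _ _ H2).
Qed.

Lemma Ccont_minus (f g : R -> C) (t : R) :
  Ccont f t -> Ccont g t -> Ccont (fun u => Cminus (f u) (g u)) t.
Proof. intros H1 H2; apply Ccont_plus; [|apply Ccont_opp]; assumption. Qed.

Lemma Ccont_mult (f g : R -> C) (t : R) :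
  Ccont f t -> Ccont g t -> Ccont (fun u => Cmult (f u) (g u)) t.
Proof.
  intros [H1 H2] [H3 H4]; split.
  - apply: (continuous_minus (fun u => _ * _) (fun u => _ * _)); apply: continuous_mult; assumption.
  - apply: (continuous_plus (fun u => _ * _) (fun u => _ * _)); apply: continuous_mult; assumption.
Qed.

Lemma Ccont_inv (f : R -> C) (t : R) :
  Ccont f t -> f t <> RtoC 0 -> Ccont (fun u => Cinv (f u)) t.
Proof.
  intros [H1 H2] Hf.
  assert (Hn : Re (f t) ^ 2 + Im (f t) ^ 2 <> 0).
  { intros H0. apply Hf. apply C_ext; simpl; nra. }
  assert (Hc : continuous (fun u => / (Re (f u) ^ 2 + Im (f u) ^ 2)) t).
  { apply continuous_Rinv_comp; [|exact Hn]. simpl.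
    apply: (continuous_plus (fun u => _ * _) (fun u => _ * _));
      (apply: (continuous_mult _ (fun u => _ * _));
       [assumption | apply: continuous_mult; [assumption | apply continuous_const]]). }
  split.
  - apply: (continuous_mult _ _ _ H1 Hc).
  - apply: (continuous_mult _ _ _ (continuous_opp _ _ H2) Hc).
Qed.

Lemma Ccont_div (f g : R -> C) (t : R) :
  Ccont f t -> Ccont g t -> g t <> RtoC 0 -> Ccont (fun u => Cdiv (f u) (g u)) t.
Proof. intros; apply Ccont_mult; [|apply Ccont_inv]; assumption. Qed.

(** In the real vector space [C], [f] is [Re f] times 1 plus [Im f] times [Ci], and each summand is
    a real function times a fixed vector. *)
Lemma Cderiv_is_derive (f : R -> C) (t : R) (l : C) :
  Cderiv f t l -> is_derive (V := C_R_NormedModule) f t l.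
Proof.
  intros [H1 H2].
  assert (H := is_derive_plus (V := C_R_NormedModule) _ _ _ _ _
    (is_derive_scal_l (V := C_R_NormedModule) _ _ _ (RtoC 1 : C) H1)
    (is_derive_scal_l (V := C_R_NormedModule) _ _ _ (Ci : C) H2)).
  evar_last; [eapply is_derive_ext; [|exact H] |].
  - intros u. apply C_ext; Rring.
  - apply C_ext; Rring.
Qed.

Lemma Ccont_continuous (f : R -> C) (t : R) :
  Ccont f t -> continuous (U := C_UniformSpace) f t.
Proof.
  intros [H1 H2]. apply (filterlim_locally (U := C_UniformSpace)). intros eps.
  generalize (filter_and _ _ (proj1 (filterlim_locally _ _) H1 eps)
    (proj1 (filterlim_locally _ _) H2 eps)).
  apply filter_imp; intros u Hu; exact Hu.
Qed.

Lemma is_RInt_Cderiv (F f : R -> C) (a b : R) :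
  (forall t, Rmin a b <= t <= Rmax a b -> Cderiv F t (f t)) ->
  (forall t, Rmin a b <= t <= Rmax a b -> Ccont f t) ->
  is_RInt (V := C_R_NormedModule) f a b (Cminus (F b) (F a)).
Proof.
  intros H1 H2.
  apply: (is_RInt_derive (V := C_R_CompleteNormedModule) F f a b).
  - intros t Ht; apply Cderiv_is_derive; auto.
  - intros t Ht; apply Ccont_continuous; auto.
Qed.

(** A mean value inequality obtained by integration, since the mean value theorem itself fails for
    complex values. It is the source of all Taylor estimates below. *)
Lemma Cderiv_bound (F f : R -> C) (G g : R -> R) (a b : R) :
  a <= b ->
  (forall t, a <= t <= b -> Cderiv F t (f t)) ->
  (forall t, a <= t <= b -> Ccont f t) ->
  (forall t, a <= t <= b -> is_derive G t (g t)) ->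
  (forall t, a <= t <= b -> continuous g t) ->
  (forall t, a <= t <= b -> Cmod (f t) <= g t) ->
  Cmod (Cminus (F b) (F a)) <= G b - G a.
Proof.
  intros Hab H1 H2 H3 H4 H5. rewrite Cmod_norm.
  apply (norm_RInt_le (V := C_R_NormedModule) f g a b _ _ Hab).
  - intros t Ht. rewrite <- Cmod_norm; auto.
  - apply is_RInt_Cderiv; rewrite Rmin_left // Rmax_right //; auto.
  - apply: (is_RInt_derive (V := R_CompleteNormedModule) G g a b);
      rewrite Rmin_left // Rmax_right //; auto.
Qed.

Lemma Cderiv_zero_const (F : R -> C) (a b : R) :
  a <= b -> (forall t, a <= t <= b -> Cderiv F t (RtoC 0)) -> F b = F a.
Proof.
  intros Hab H.
  assert (H0 : Cmod (Cminus (F b) (F a)) <= 0 - 0).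
  { apply (Cderiv_bound F (fun _ => RtoC 0) (fun _ => 0) (fun _ => 0)); auto.
    - intros; apply Ccont_const.
    - intros t _; apply (is_derive_const (K := R_AbsRing) (V := R_NormedModule) 0 t).
    - intros; apply continuous_const.
    - intros; rewrite Cmod_0; lra. }
  apply Ceq_minus, Cmod_eq_0. generalize (Cmod_ge_0 (Cminus (F b) (F a))); lra.
Qed.

Lemma Cderiv_Cexp (f : R -> C) (t : R) (l : C) :
  Cderiv f t l -> Cderiv (fun u => Cexp (f u)) t (Cmult l (Cexp (f t))).
Proof.
  intros [H1 H2]; split; simpl.
  - evar_last.
    + apply is_derive_Rmult.
      * apply: (is_derive_comp exp); [apply is_derive_exp | exact H1].
      * apply: (is_derive_comp cos); [apply is_derive_cos | exact H2].
    + Rring.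
  - evar_last.
    + apply is_derive_Rmult.
      * apply: (is_derive_comp exp); [apply is_derive_exp | exact H1].
      * apply: (is_derive_comp sin); [apply is_derive_sin | exact H2].
    + Rring.
Qed.

Lemma Cexp_plus (x y : C) : Cexp (Cplus x y) = Cmult (Cexp x) (Cexp y).
Proof.
  apply C_ext; simpl; rewrite exp_plus; [rewrite cos_plus | rewrite sin_plus]; Rring.
Qed.

Lemma Cexp_RtoC (x : R) : Cexp (RtoC x) = RtoC (exp x).
Proof. apply C_ext; simpl; [rewrite cos_0 | rewrite sin_0]; ring. Qed.

Lemma Cmod_Cexp (x : C) : Cmod (Cexp x) = exp (Re x).
Proof.
  unfold Cmod; simpl.
  replace (_ + _) with ((exp (Re x))²).
  - apply sqrt_Rsqr. apply Rlt_le, exp_pos.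
  - generalize (sin2_cos2 (Im x)); unfold Rsqr; intros H.
    transitivity (exp (Re x) * exp (Re x) * (sin (Im x) * sin (Im x) + cos (Im x) * cos (Im x))).
    + rewrite H; ring.
    + ring.
Qed.

Lemma Cderiv_Cexp_lin (z : C) (t : R) :
  Cderiv (fun u => Cexp (Copp (Cmult z (RtoC u)))) t
    (Cmult (Copp z) (Cexp (Copp (Cmult z (RtoC t))))).
Proof.
  apply (Cderiv_Cexp (fun u => Copp (Cmult z (RtoC u)))).
  eapply Cderiv_eq.
  - apply Cderiv_opp, Cderiv_scal, Cderiv_RtoC. apply (is_derive_id (K := R_AbsRing)).
  - unfold one; simpl; ring.
Qed.

(** * Improper integrals over the half-line *)

Definition ctends (Fl : (R -> Prop) -> Prop) (F : R -> C) (A : C) : Prop :=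
  forall eps : R, 0 < eps -> Fl (fun t => Cmod (Cminus (F t) A) < eps).

Lemma ctends_filterlim (Fl : (R -> Prop) -> Prop) {FF : Filter Fl} (F : R -> C) (A : C) :
  ctends Fl F A <-> filterlim F Fl (locally (T := C_UniformSpace) A).
Proof.
  split.
  - intros H. apply (filterlim_locally_ball_norm (U := C_R_NormedModule)).
    intros eps. generalize (H eps (cond_pos eps)). apply filter_imp; intros t Ht.
    red. rewrite -Cmod_norm. exact Ht.
  - intros H eps He.
    generalize (proj1 (filterlim_locally_ball_norm (U := C_R_NormedModule) F A) H (mkposreal eps He)).
    apply filter_imp; intros t Ht. red in Ht. rewrite -Cmod_norm in Ht. exact Ht.
Qed.

Lemma ctends_plus (Fl : (R -> Prop) -> Prop) {FF : Filter Fl} (F G : R -> C) (A B : C) :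
  ctends Fl F A -> ctends Fl G B -> ctends Fl (fun t => Cplus (F t) (G t)) (Cplus A B).
Proof.
  intros H1 H2 eps He.
  assert (He2 : 0 < eps / 2) by lra.
  generalize (filter_and _ _ (H1 _ He2) (H2 _ He2)). apply filter_imp; intros t [Ht1 Ht2].
  replace (Cminus _ _) with (Cplus (Cminus (F t) A) (Cminus (G t) B)) by ring.
  eapply Rle_lt_trans; [apply Cmod_triangle | lra].
Qed.

Lemma ctends_scal (Fl : (R -> Prop) -> Prop) {FF : Filter Fl} (k : C) (F : R -> C) (A : C) :
  ctends Fl F A -> ctends Fl (fun t => Cmult k (F t)) (Cmult k A).
Proof.
  intros H eps He.
  assert (Hk : 0 < Cmod k + 1) by (generalize (Cmod_ge_0 k); lra).
  assert (He2 : 0 < eps / (Cmod k + 1)) by (apply Rdiv_lt_0_compat; lra).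
  generalize (H _ He2). apply filter_imp; intros t Ht.
  replace (Cminus _ _) with (Cmult k (Cminus (F t) A)) by ring.
  rewrite Cmod_mult.
  apply (Rmult_lt_compat_r (Cmod k + 1)) in Ht; [|lra].
  replace (eps / (Cmod k + 1) * (Cmod k + 1)) with eps in Ht by (field; lra).
  generalize (Cmod_ge_0 (Cminus (F t) A)); nra.
Qed.

Lemma ctends_bound (Fl : (R -> Prop) -> Prop) {FF : Filter Fl} (F : R -> C) (g : R -> R) :
  Fl (fun t => Cmod (F t) <= g t) -> filterlim g Fl (locally 0) -> ctends Fl F (RtoC 0).
Proof.
  intros H1 H2 eps He.
  generalize (filter_and _ _ H1 (proj1 (filterlim_locally g 0) H2 (mkposreal eps He))).
  apply filter_imp; intros t [Ht1 Ht2].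
  replace (Cminus _ _) with (F t) by ring.
  apply Rle_lt_trans with (1 := Ht1).
  cbn in Ht2; unfold AbsRing_ball, abs, minus, plus, opp in Ht2; cbn in Ht2.
  apply Rabs_def2 in Ht2; lra.
Qed.

(** Convergence is witnessed by a primitive with a limit at each end. Linearity then reduces to that
    of derivatives and limits, and an explicit primitive yields convergence and value at once. *)
Definition improper (f : R -> C) (v : C) : Prop :=
  exists (F : R -> C) (A B : C),
    (forall t, 0 < t -> Cderiv F t (f t)) /\ (forall t, 0 < t -> Ccont f t) /\
    ctends (at_right 0) F A /\ ctends (Rbar_locally p_infty) F B /\ v = Cminus B A.

Lemma locally_pos (t : R) (P : R -> Prop) :
  0 < t -> (forall u, 0 < u -> P u) -> locally t P.
Proof.
  intros Ht H. apply filter_imp with (P := fun u => 0 < u); [exact H|].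
  apply (open_gt 0); exact Ht.
Qed.

Lemma at_right_pos (P : R -> Prop) : (forall t, 0 < t -> P t) -> at_right 0 P.
Proof. intros H. exists (mkposreal 1 Rlt_0_1). intros y _ Hy; apply H; exact Hy. Qed.

Lemma p_infty_pos (P : R -> Prop) : (forall t, 0 < t -> P t) -> Rbar_locally p_infty P.
Proof. intros H. exists 0. exact H. Qed.

Lemma improper_ext (f g : R -> C) (v : C) :
  (forall t, 0 < t -> f t = g t) -> improper f v -> improper g v.
Proof.
  intros H (F & A & B & H1 & H2 & H3 & H4 & H5).
  exists F, A, B; split; [|split; [|split; [|split]]]; auto.
  - intros; rewrite -H //; apply H1; assumption.
  - intros; apply (Ccont_ext_loc f); [apply locally_pos|]; auto.
Qed.

Lemma improper_plus (f g : R -> C) (v w : C) :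
  improper f v -> improper g w -> improper (fun t => Cplus (f t) (g t)) (Cplus v w).
Proof.
  intros (F & A & B & H1 & H2 & H3 & H4 & H5) (G & A' & B' & K1 & K2 & K3 & K4 & K5).
  exists (fun t => Cplus (F t) (G t)), (Cplus A A'), (Cplus B B').
  split; [|split; [|split; [|split]]].
  - intros; apply Cderiv_plus; auto.
  - intros; apply Ccont_plus; auto.
  - apply ctends_plus; auto; apply _.
  - apply ctends_plus; auto; apply _.
  - subst; ring.
Qed.

Lemma improper_scal (k : C) (f : R -> C) (v : C) :
  improper f v -> improper (fun t => Cmult k (f t)) (Cmult k v).
Proof.
  intros (F & A & B & H1 & H2 & H3 & H4 & H5).
  exists (fun t => Cmult k (F t)), (Cmult k A), (Cmult k B).
  split; [|split; [|split; [|split]]].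
  - intros; apply Cderiv_scal; auto.
  - intros; apply Ccont_mult; [apply Ccont_const | auto].
  - apply ctends_scal; auto; apply _.
  - apply ctends_scal; auto; apply _.
  - subst; ring.
Qed.

Lemma improper_minus (f g : R -> C) (v w : C) :
  improper f v -> improper g w -> improper (fun t => Cminus (f t) (g t)) (Cminus v w).
Proof.
  intros H1 H2. apply (improper_ext (fun t => Cplus (f t) (Cmult (Copp (RtoC 1)) (g t)))).
  - intros; ring.
  - replace (Cminus v w) with (Cplus v (Cmult (Copp (RtoC 1)) w)) by ring.
    apply improper_plus; [|apply improper_scal]; assumption.
Qed.

Lemma improper_is_RInt_gen (f : R -> C) (v : C) :
  improper f v ->
  is_RInt_gen (V := C_R_NormedModule) f (at_right 0) (Rbar_locally p_infty) v.
Proof.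
  intros (F & A & B & H1 & H2 & H3 & H4 & ->).
  apply filterlimi_lim_ext_loc with (f := fun ab => Cminus (F (snd ab)) (F (fst ab))).
  - apply (Filter_prod _ _ _ (fun x => 0 < x) (fun x => 0 < x));
      [apply at_right_pos; auto | apply p_infty_pos; auto |].
    intros x y Hx Hy; simpl.
    assert (0 < Rmin x y) by (apply Rmin_glb_lt; assumption).
    apply is_RInt_Cderiv; intros t Ht; [apply H1 | apply H2]; lra.
  - apply ctends_filterlim in H3; [|apply _]. apply ctends_filterlim in H4; [|apply _].
    apply (filterlim_comp_2 (fun ab => F (snd ab)) (fun ab => F (fst ab))
      (fun x y => minus (G := C_R_NormedModule) x y)
      (G := locally (T := C_UniformSpace) B) (H := locally (T := C_UniformSpace) A)).
    + apply filterlim_comp with (2 := H4). apply filterlim_snd.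
    + apply filterlim_comp with (2 := H3). apply filterlim_fst.
    + unfold minus. eapply filterlim_comp_2; [apply filterlim_fst | | apply (filterlim_plus (V := C_R_NormedModule))].
      eapply filterlim_comp; [apply filterlim_snd | apply (filterlim_opp (V := C_R_NormedModule))].
Qed.

Lemma improper_unique (f : R -> C) (v w : C) : improper f v -> improper f w -> v = w.
Proof.
  intros H1%improper_is_RInt_gen H2%improper_is_RInt_gen.
  rewrite -(is_RInt_gen_unique (V := C_R_CompleteNormedModule) f v H1).
  exact (is_RInt_gen_unique (V := C_R_CompleteNormedModule) f w H2).
Qed.

(** Increments of [F] are dominated by those of [G], so [F] inherits the Cauchy criterion, at either
    end of the half-line. *)
Lemma ctends_cauchy (Fl : (R -> Prop) -> Prop) {FF : ProperFilter Fl} (F : R -> C) (G : R -> R) (b : C) :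
  Fl (fun x => 0 < x) ->
  (forall x y, 0 < x -> x <= y -> Cmod (Cminus (F y) (F x)) <= G y - G x) ->
  ctends Fl (fun t => RtoC (G t)) b -> exists B, ctends Fl F B.
Proof.
  intros Hpos H Hb.
  assert (HC : forall eps : posreal, exists P : R -> Prop, Fl P /\
     (forall u v : R, P u -> P v -> ball (M := C_UniformSpace) (F u) eps (F v))).
  { intros eps. exists (fun x => 0 < x /\ Cmod (Cminus (RtoC (G x)) b) < eps / 2). split.
    - apply filter_and; [exact Hpos|]. apply Hb. generalize (cond_pos eps); lra.
    - intros u v [Hu Hu'] [Hv Hv'].
      apply C_NormedModule_mixin_compat1.
      assert (HG : Rabs (G v - G u) < eps).
      { rewrite -Cmod_R RtoC_minus.
        replace (Cminus (RtoC (G v)) (RtoC (G u))) with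
          (Cplus (Cminus (RtoC (G v)) b) (Copp (Cminus (RtoC (G u)) b))) by ring.
        eapply Rle_lt_trans; [apply Cmod_triangle|]. rewrite Cmod_opp; lra. }
      change (Cmod (Cminus (F v) (F u)) < eps).
      destruct (Rle_dec u v) as [Huv|Huv].
      + eapply Rle_lt_trans; [apply H; assumption|].
        apply Rabs_def2 in HG; lra.
      + replace (Cminus (F v) (F u)) with (Copp (Cminus (F u) (F v))) by ring.
        rewrite Cmod_opp. eapply Rle_lt_trans; [apply H; lra|].
        apply Rabs_def2 in HG; lra. }
  apply (filterlim_locally_cauchy (U := C_R_CompleteNormedModule)) in HC.
  destruct HC as [B HB]. exists B. apply ctends_filterlim; [apply _ | exact HB].
Qed.

Lemma is_derive_RInt_pos (f : R -> R) (t : R) :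
  (forall t, 0 < t -> continuous f t) -> 0 < t -> is_derive (fun x => RInt f 1 x) t (f t).
Proof.
  intros Hf Ht. apply is_derive_RInt with (a := 1); [|apply Hf; exact Ht].
  apply locally_pos; [exact Ht|]. intros u Hu.
  apply (RInt_correct (V := R_CompleteNormedModule)). apply ex_RInt_continuous.
  intros z Hz. apply Hf. assert (0 < Rmin 1 u) by (apply Rmin_glb_lt; lra). lra.
Qed.

(** The comparison test, with the integral from 1 as primitive. The bound on [v] is the limit of the
    bound on the increments over [[x, y]]. *)
Lemma improper_dominated (f : R -> C) (g : R -> R) (l : R) :
  (forall t, 0 < t -> Ccont f t) -> (forall t, 0 < t -> Cmod (f t) <= g t) ->
  improper (fun t => RtoC (g t)) (RtoC l) -> exists v, improper f v /\ Cmod v <= l.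
Proof.
  intros Hf Hfg (G & A & B & H1 & H2 & H3 & H4 & Hl).
  set (F := fun t => (RInt (fun u => Re (f u)) 1 t, RInt (fun u => Im (f u)) 1 t) : C).
  assert (HF : forall t, 0 < t -> Cderiv F t (f t)).
  { intros t Ht; split; simpl.
    - apply (is_derive_RInt_pos (fun u => Re (f u))); [|exact Ht]. intros u Hu; apply (Hf u Hu).
    - apply (is_derive_RInt_pos (fun u => Im (f u))); [|exact Ht]. intros u Hu; apply (Hf u Hu). }
  assert (Hb : forall x y, 0 < x -> x <= y -> Cmod (Cminus (F y) (F x)) <= Re (G y) - Re (G x)).
  { intros x y Hx Hxy.
    apply (Cderiv_bound F f (fun t => Re (G t)) g); auto; intros t Ht.
    - apply HF; lra.
    - apply Hf; lra.
    - apply (H1 t); lra.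
    - apply (H2 t); lra.
    - apply Hfg; lra. }
  assert (Hre : forall Fl {FF : Filter Fl} D, ctends Fl G D -> ctends Fl (fun t => RtoC (Re (G t))) (RtoC (Re D))).
  { intros Fl FF D H eps He. generalize (H eps He). apply filter_imp; intros t Ht.
    rewrite -RtoC_minus Cmod_R. eapply Rle_lt_trans; [|exact Ht].
    apply (re_le_Cmod (Cminus (G t) D)). }
  apply Hre in H3; [|apply _]. apply Hre in H4; [|apply _].
  destruct (ctends_cauchy (at_right 0) F (fun t => Re (G t)) (RtoC (Re A))) as [a Ha]; auto.
  { apply at_right_pos; auto. }
  destruct (ctends_cauchy (Rbar_locally p_infty) F (fun t => Re (G t)) (RtoC (Re B))) as [b Hb']; auto.
  { apply p_infty_pos; auto. }
  exists (Cminus b a). split.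
  - exists F, a, b; auto.
  - apply le_epsilon; intros eps He.
    (* Four limits are approximated: those of [F] and of the primitive [G], at each of the two
       ends. *)
    assert (He' : 0 < eps / 4) by lra.
    assert (Hx : at_right 0 (fun t => 0 < t < 1)).
    { exists (mkposreal 1 Rlt_0_1). intros y Hy Hy0; split; [exact Hy0|].
      cbn in Hy; unfold AbsRing_ball, abs, minus, plus, opp in Hy; cbn in Hy.
      apply Rabs_def2 in Hy; lra. }
    destruct (filter_ex (F := at_right 0) _ (filter_and _ _ Hx
       (filter_and _ _ (Ha _ He') (H3 _ He')))) as [x (Hx1 & Hx2 & Hx3)].
    assert (Hy : Rbar_locally p_infty (fun t => 1 < t)) by (exists 1; auto).
    destruct (filter_ex (F := Rbar_locally p_infty) _ (filter_and _ _ Hy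
       (filter_and _ _ (Hb' _ He') (H4 _ He')))) as [y (Hy1 & Hy2 & Hy3)].
    assert (Hl' : l = Re B - Re A) by (apply (f_equal Re) in Hl; exact Hl).
    rewrite -RtoC_minus Cmod_R in Hx3. rewrite -RtoC_minus Cmod_R in Hy3.
    apply Rabs_def2 in Hx3. apply Rabs_def2 in Hy3.
    replace (Cminus b a) with
      (Cplus (Cminus (F y) (F x)) (Cplus (Copp (Cminus (F y) b)) (Cminus (F x) a))) by ring.
    eapply Rle_trans; [apply Cmod_triangle|].
    generalize (Cmod_triangle (Copp (Cminus (F y) b)) (Cminus (F x) a)).
    rewrite Cmod_opp. generalize (Hb x y); lra.
Qed.

(** * Decay estimates and limits at the two ends *)

Lemma RtoC_neq_0 (x : R) : x <> 0 -> RtoC x <> RtoC 0.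
Proof. intros H K; apply H, RtoC_inj, K. Qed.

Lemma exp_mult_pow (n : nat) (y : R) : exp (INR n * y) = exp y ^ n.
Proof.
  induction n as [|n IH].
  - rewrite Rmult_0_l exp_0; reflexivity.
  - rewrite S_INR Rmult_plus_distr_r exp_plus IH; simpl; rewrite Rmult_1_l; ring.
Qed.

(** From [y <= e^y] with [y = a t / (k + 1)], raised to the power [k + 1]; this fixes the constant
    [((k + 1) / a)^(k + 1)]. *)
Lemma pow_exp_decay (a : R) (k : nat) :
  0 < a -> exists M, forall t, 0 < t -> t ^ k * exp (- (a * t)) <= M / t.
Proof.
  intros Ha. set (n := INR (S k)).
  assert (Hn : 0 < n) by (apply lt_0_INR; lia).
  exists ((n / a) ^ S k). intros t Ht.
  assert (Hp : 0 < a * t) by (apply Rmult_lt_0_compat; lra).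
  assert (H : (a * t / n) ^ S k <= exp (a * t)).
  { replace (a * t) with (INR (S k) * (a * t / n)) at 2 by (fold n; field; lra).
    rewrite exp_mult_pow. apply pow_incr. split.
    - apply Rlt_le, Rdiv_lt_0_compat; lra.
    - generalize (exp_ineq1_le (a * t / n)); lra. }
  replace (a * t / n) with (t * / (n / a)) in H by (field; split; lra).
  assert (Hna : 0 < n / a) by (apply Rdiv_lt_0_compat; lra).
  rewrite Rpow_mult_distr pow_inv in H.
  set (c := (n / a) ^ S k) in *.
  assert (Hc : 0 < c) by (apply pow_lt; exact Hna).
  rewrite exp_Ropp. assert (He := exp_pos (a * t)).
  apply (Rmult_le_reg_r (t * exp (a * t) * / c)).
  - apply Rmult_lt_0_compat; [apply Rmult_lt_0_compat; lra | apply Rinv_0_lt_compat; lra].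
  - replace (t ^ k * / exp (a * t) * (t * exp (a * t) * / c)) with (t ^ S k * / c) by (simpl; field; lra).
    replace (c / t * (t * exp (a * t) * / c)) with (exp (a * t)) by (field; lra).
    exact H.
Qed.

Lemma filterlim_inv_p_infty (M : R) : filterlim (fun t => M / t) (Rbar_locally p_infty) (locally 0).
Proof.
  assert (H := is_lim_scal_l _ M p_infty _ (is_lim_inv _ _ _ (is_lim_id p_infty) (fun H => ltac:(discriminate)))).
  replace 0 with (real (Rbar_mult M (Rbar_inv p_infty))).
  - exact H.
  - simpl; ring.
Qed.

Lemma filterlim_lin_at_right (M : R) : filterlim (fun t => M * t) (at_right 0) (locally 0).
Proof.
  assert (H : continuous (fun t => M * t) 0)
    by (apply: (continuous_mult (fun _ => M)); [apply continuous_const | apply continuous_id]).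
  unfold continuous in H. rewrite Rmult_0_r in H.
  eapply filterlim_filter_le_1; [|exact H].
  intros P HP. apply filter_le_within. exact HP.
Qed.

Lemma ctends_at_right_bound (F : R -> C) (M : R) :
  (forall t, 0 < t < 1 -> Cmod (F t) <= M * t) -> ctends (at_right 0) F (RtoC 0).
Proof.
  intros H. apply (ctends_bound (at_right 0) F (fun t => M * t)).
  - exists (mkposreal 1 Rlt_0_1). intros y Hy Hy0.
    cbn in Hy; unfold AbsRing_ball, abs, minus, plus, opp in Hy; cbn in Hy.
    apply Rabs_def2 in Hy; apply H; lra.
  - apply filterlim_lin_at_right.
Qed.

Lemma ctends_p_infty_bound (F : R -> C) (M : R) :
  (forall t, 1 < t -> Cmod (F t) <= M / t) -> ctends (Rbar_locally p_infty) F (RtoC 0).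
Proof.
  intros H. apply (ctends_bound (Rbar_locally p_infty) F (fun t => M / t)).
  - exists 1; exact H.
  - apply filterlim_inv_p_infty.
Qed.

Lemma ctends_plus_const (Fl : (R -> Prop) -> Prop) {FF : Filter Fl} (F : R -> C) (A : C) :
  ctends Fl (fun t => Cminus (F t) A) (RtoC 0) -> ctends Fl F A.
Proof.
  intros H eps He. generalize (H eps He). apply filter_imp; intros t.
  replace (Cminus (Cminus (F t) A) (RtoC 0)) with (Cminus (F t) A) by ring. auto.
Qed.

(** * The complex exponential and its elementary integrals *)

Definition cexpm (z : C) (t : R) : C := Cexp (Copp (Cmult z (RtoC t))).

Lemma Cmod_cexpm (z : C) (t : R) : Cmod (cexpm z t) = exp (- (Re z * t)).
Proof. unfold cexpm. rewrite Cmod_Cexp. f_equal. Rring. Qed.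

Lemma cexpm_RtoC (a t : R) : cexpm (RtoC a) t = RtoC (exp (- (a * t))).
Proof. unfold cexpm. rewrite -RtoC_mult -RtoC_opp. apply Cexp_RtoC. Qed.

Lemma Cderiv_cexpm (z : C) (t : R) : Cderiv (cexpm z) t (Cmult (Copp z) (cexpm z t)).
Proof. apply Cderiv_Cexp_lin. Qed.

Lemma Ccont_cexpm (z : C) (t : R) : Ccont (cexpm z) t.
Proof. exact (Cderiv_cont _ _ _ (Cderiv_cexpm z t)). Qed.

Lemma Re_pos_neq_0 (z : C) : 0 < Re z -> z <> RtoC 0.
Proof. intros H ->; simpl in H; lra. Qed.

Lemma exp_neg_le_1 (x : R) : 0 <= x -> exp (- x) <= 1.
Proof.
  intros [H| <-].
  - rewrite -exp_0. apply Rlt_le, exp_increasing; lra.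
  - rewrite Ropp_0 exp_0; lra.
Qed.

(** The half-plane [Re <= m] is convex, so the derivative of the exponential is bounded by [exp m]
    along the segment from [x] to [y]. *)
Lemma Cexp_lipschitz (x y : C) (m : R) :
  Re x <= m -> Re y <= m -> Cmod (Cminus (Cexp y) (Cexp x)) <= Cmod (Cminus y x) * exp m.
Proof.
  intros Hx Hy. set (d := Cminus y x).
  assert (Hd : forall u, Cderiv (fun u => Cexp (Cplus x (Cmult d (RtoC u)))) u
     (Cmult d (Cexp (Cplus x (Cmult d (RtoC u)))))).
  { intros u. apply (Cderiv_Cexp (fun u => Cplus x (Cmult d (RtoC u)))).
    eapply Cderiv_eq; [apply Cderiv_plus; [apply Cderiv_const | apply Cderiv_scal, Cderiv_RtoC, (is_derive_id (K := R_AbsRing))]|].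
    unfold one; simpl; ring. }
  assert (H := Cderiv_bound (fun u => Cexp (Cplus x (Cmult d (RtoC u)))) _
    (fun u => u * (Cmod d * exp m)) (fun _ => Cmod d * exp m) 0 1 Rle_0_1
    (fun t _ => Hd t)).
  replace y with (Cplus x (Cmult d (RtoC 1))) at 1 by (unfold d; ring).
  replace x with (Cplus x (Cmult d (RtoC 0))) at 2 by ring.
  eapply Rle_trans; [apply H | right; ring].
  - intros t _. apply Ccont_mult; [apply Ccont_const | exact (Cderiv_cont _ _ _ (Hd t))].
  - intros t _. auto_derive; [exact I | ring].
  - intros t _. apply continuous_const.
  - intros t Ht. rewrite Cmod_mult Cmod_Cexp. apply Rmult_le_compat_l; [apply Cmod_ge_0|].
    assert (Hr : Re (Cplus x (Cmult d (RtoC t))) = (1 - t) * Re x + t * Re y) by (unfold d; Rring).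
    rewrite Hr. destruct (Rle_lt_or_eq_dec ((1 - t) * Re x + t * Re y) m) as [Hlt| ->]; [nra | | lra].
    apply Rlt_le, exp_increasing, Hlt.
Qed.

(** Along the segment the remainder has derivative [d (e^(x + d u) - e^x)], to which the Lipschitz
    bound applies. The factor 1/2 is given up. *)
Lemma Cexp_taylor2 (x y : C) (m : R) :
  Re x <= m -> Re y <= m ->
  Cmod (Cminus (Cminus (Cexp y) (Cexp x)) (Cmult (Cminus y x) (Cexp x))) <= Cmod (Cminus y x) ^ 2 * exp m.
Proof.
  intros Hx Hy. set (d := Cminus y x).
  assert (Hd : forall u, Cderiv (fun u => Cminus (Cexp (Cplus x (Cmult d (RtoC u)))) (Cmult (Cmult d (Cexp x)) (RtoC u))) u
     (Cmult d (Cminus (Cexp (Cplus x (Cmult d (RtoC u)))) (Cexp x)))).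
  { intros u. eapply Cderiv_eq.
    - apply Cderiv_minus.
      + apply (Cderiv_Cexp (fun u => Cplus x (Cmult d (RtoC u)))).
        apply Cderiv_plus; [apply Cderiv_const | apply Cderiv_scal, Cderiv_RtoC, (is_derive_id (K := R_AbsRing))].
      + apply Cderiv_scal, Cderiv_RtoC, (is_derive_id (K := R_AbsRing)).
    - unfold one; simpl; ring. }
  assert (H := Cderiv_bound _ _
    (fun u => u * (Cmod d ^ 2 * exp m)) (fun _ => Cmod d ^ 2 * exp m) 0 1 Rle_0_1
    (fun t _ => Hd t)). cbv beta in H.
  replace (Cminus (Cminus (Cexp y) (Cexp x)) (Cmult d (Cexp x))) with
    (Cminus (Cminus (Cexp (Cplus x (Cmult d (RtoC 1)))) (Cmult (Cmult d (Cexp x)) (RtoC 1)))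
      (Cminus (Cexp (Cplus x (Cmult d (RtoC 0)))) (Cmult (Cmult d (Cexp x)) (RtoC 0)))).
  2: { replace (Cplus x (Cmult d (RtoC 1))) with y by (unfold d; ring).
       replace (Cplus x (Cmult d (RtoC 0))) with x by ring. ring. }
  eapply Rle_trans; [apply H | right; ring].
  - intros t _. apply Ccont_mult; [apply Ccont_const | apply Ccont_minus; [|apply Ccont_const]].
    eapply (Cderiv_cont _ _ _). apply (Cderiv_Cexp (fun u => Cplus x (Cmult d (RtoC u)))).
    apply Cderiv_plus; [apply Cderiv_const | apply Cderiv_scal, Cderiv_RtoC, (is_derive_id (K := R_AbsRing))].
  - intros t _. auto_derive; [exact I | ring].
  - intros t _. apply continuous_const.
  - intros t Ht. rewrite Cmod_mult.
    assert (Hr : Re (Cplus x (Cmult d (RtoC t))) = (1 - t) * Re x + t * Re y) by (unfold d; Rring).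
    assert (HL := Cexp_lipschitz x (Cplus x (Cmult d (RtoC t))) m Hx ltac:(rewrite Hr; nra)).
    replace (Cminus (Cplus x (Cmult d (RtoC t))) x) with (Cmult d (RtoC t)) in HL by ring.
    rewrite Cmod_mult Cmod_R Rabs_pos_eq in HL; [|lra].
    generalize (Cmod_ge_0 d) (exp_pos m); intros Hd0 He.
    replace (Cmod d ^ 2 * exp m) with (Cmod d * (Cmod d * 1 * exp m)) by ring.
    apply Rmult_le_compat_l; [exact Hd0|]. eapply Rle_trans; [exact HL|].
    apply Rmult_le_compat_r; [lra|]. apply Rmult_le_compat_l; lra.
Qed.

Lemma improper_cexpm (z : C) : 0 < Re z -> improper (cexpm z) (Cinv z).
Proof.
  intros Hz. assert (Hz0 := Re_pos_neq_0 z Hz).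
  exists (fun t => Cmult (Copp (Cinv z)) (cexpm z t)), (Copp (Cinv z)), (RtoC 0).
  split; [|split; [|split; [|split]]].
  - intros t _. eapply Cderiv_eq; [apply Cderiv_scal, Cderiv_cexpm | field; exact Hz0].
  - intros t _. apply Ccont_cexpm.
  - rewrite -[X in ctends _ _ X]Cmult_1_r.
    apply (ctends_scal (at_right 0)), (ctends_plus_const (at_right 0)).
    apply ctends_at_right_bound with (M := Cmod z). intros t Ht.
    assert (HL := Cexp_lipschitz (RtoC 0) (Copp (Cmult z (RtoC t))) 0).
    replace (RtoC 1) with (Cexp (RtoC 0)) by (rewrite Cexp_RtoC exp_0; reflexivity).
    eapply Rle_trans; [apply HL|].
    + simpl; lra.
    + replace (Re (Copp (Cmult z (RtoC t)))) with (- (Re z * t)) by Rring. nra.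
    + right. replace (Cminus (Copp (Cmult z (RtoC t))) (RtoC 0)) with (Copp (Cmult z (RtoC t))) by ring.
      rewrite Cmod_opp Cmod_mult Cmod_R Rabs_pos_eq; [rewrite exp_0; ring | lra].
  - rewrite -(Cmult_0_r (Copp (Cinv z))).
    apply (ctends_scal (Rbar_locally p_infty)).
    destruct (pow_exp_decay (Re z) 0 Hz) as [M HM].
    apply ctends_p_infty_bound with (M := M). intros t Ht.
    rewrite Cmod_cexpm. specialize (HM t ltac:(lra)). simpl in HM; lra.
  - ring.
Qed.

Lemma improper_pow_exp (a : R) (k : nat) :
  0 < a -> improper (fun t => RtoC (t ^ k * exp (- (a * t)))) (RtoC (INR (fact k) / a ^ S k)).
Proof.
  intros Ha. induction k as [|k IH].
  - apply improper_ext with (f := cexpm (RtoC a)).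
    + intros t _. rewrite cexpm_RtoC. f_equal; simpl; ring.
    + replace (RtoC (INR (fact 0) / a ^ 1)) with (Cinv (RtoC a)).
      * apply improper_cexpm. exact Ha.
      * rewrite -RtoC_inv; [f_equal; simpl; field; lra | lra].
  (* Integration by parts written as a difference of integrands: its primitive
     [- t^(k+1) e^(-at) / a] vanishes at both ends. *)
  - assert (H : improper (fun t => RtoC (t ^ S k * exp (- (a * t)) - INR (S k) / a * (t ^ k * exp (- (a * t))))) (RtoC 0)).
    { exists (fun t => RtoC (- / a * (t ^ S k * exp (- (a * t))))), (RtoC 0), (RtoC 0).
      assert (Hd : forall t, is_derive (fun t => - / a * (t ^ S k * exp (- (a * t)))) t
         (t ^ S k * exp (- (a * t)) - INR (S k) / a * (t ^ k * exp (- (a * t))))).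
      { intros t. auto_derive; [exact I|]. rewrite -/(INR (S k)). simpl pred. simpl pow. field. lra. }
      split; [|split; [|split; [|split]]].
      - intros t _. apply Cderiv_RtoC, Hd.
      - intros t _. apply Ccont_RtoC. apply: ex_derive_continuous. auto_derive. exact I.
      - apply ctends_at_right_bound with (M := / a). intros t Ht.
        assert (0 < / a) by (apply Rinv_0_lt_compat; lra).
        assert (H0 : 0 <= t ^ k <= 1) by (split; [apply pow_le; lra | rewrite -(pow1 k); apply pow_incr; lra]).
        rewrite Cmod_R Rabs_mult Rabs_Ropp Rabs_pos_eq; [|lra].
        apply Rmult_le_compat_l; [lra|]. simpl.
        assert (He := exp_pos (- (a * t))). assert (He1 := exp_neg_le_1 (a * t) ltac:(nra)).
        rewrite Rabs_pos_eq.
        + rewrite Rmult_assoc -[X in _ <= X]Rmult_1_r. apply Rmult_le_compat_l; [lra|]. nra.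
        + apply Rmult_le_pos; [apply Rmult_le_pos|]; lra.
      - destruct (pow_exp_decay a (S k) Ha) as [M HM].
        apply ctends_p_infty_bound with (M := / a * M). intros t Ht.
        assert (0 < / a) by (apply Rinv_0_lt_compat; lra).
        rewrite Cmod_R Rabs_mult Rabs_Ropp Rabs_pos_eq; [|lra].
        unfold Rdiv; rewrite Rmult_assoc. apply Rmult_le_compat_l; [lra|].
        rewrite Rabs_pos_eq; [apply HM; lra|].
        apply Rmult_le_pos; [apply pow_le; lra | apply Rlt_le, exp_pos].
      - ring. }
    assert (H2 := improper_plus _ _ _ _ H (improper_scal (RtoC (INR (S k) / a)) _ _ IH)).
    replace (RtoC (INR (fact (S k)) / a ^ S (S k))) with
      (Cplus (RtoC 0) (Cmult (RtoC (INR (S k) / a)) (RtoC (INR (fact k) / a ^ S k)))).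
    + apply improper_ext with (2 := H2).
      intros t _. rewrite -RtoC_mult -RtoC_plus. f_equal; ring.
    + rewrite -RtoC_mult -RtoC_plus. f_equal. rewrite fact_simpl mult_INR. simpl pow. field.
      split; [apply pow_nonzero|]; lra.
Qed.

(** * Frullani's formula and the principal logarithm *)

Definition frullani_integrand (z : C) (t : R) : C :=
  Cdiv (Cminus (cexpm z t) (cexpm (RtoC 1) t)) (RtoC t).

Lemma Ccont_id_RtoC (t : R) : Ccont RtoC t.
Proof. apply (Ccont_RtoC (fun u => u)), continuous_id. Qed.

Lemma cexpm_diff_bound (z z' : C) (b t : R) :
  b <= Re z -> b <= Re z' -> 0 < t ->
  Cmod (Cminus (cexpm z' t) (cexpm z t)) <= Cmod (Cminus z' z) * t * exp (- (b * t)).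
Proof.
  intros Hz Hz' Ht.
  eapply Rle_trans; [apply (Cexp_lipschitz _ _ (- (b * t)))|].
  - replace (Re (Copp (Cmult z (RtoC t)))) with (- (Re z * t)) by Rring. nra.
  - replace (Re (Copp (Cmult z' (RtoC t)))) with (- (Re z' * t)) by Rring. nra.
  - right. replace (Cminus _ _) with (Copp (Cmult (Cminus z' z) (RtoC t))) by ring.
    rewrite Cmod_opp Cmod_mult Cmod_R Rabs_pos_eq; [ring | lra].
Qed.

(** The difference of the exponentials is at most [Cmod (z - 1) t e^(-bt)] with the common decay
    rate [b = min (Re z, 1)], and its factor [t] cancels the denominator. *)
Lemma frullani_exists (z : C) : 0 < Re z -> exists v, improper (frullani_integrand z) v.
Proof.
  intros Hz. set (b := Rmin (Re z) 1).
  assert (Hb : 0 < b) by (apply Rmin_glb_lt; lra).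
  assert (Hbz : b <= Re z) by apply Rmin_l. assert (Hb1 : b <= 1) by apply Rmin_r.
  destruct (improper_dominated (frullani_integrand z)
    (fun t => Cmod (Cminus z (RtoC 1)) * (t ^ 0 * exp (- (b * t))))
    (Cmod (Cminus z (RtoC 1)) * (INR (fact 0) / b ^ 1))) as [v [Hv _]].
  - intros t Ht. apply Ccont_div; [apply Ccont_minus; apply Ccont_cexpm | apply Ccont_id_RtoC |].
    apply RtoC_neq_0; lra.
  - intros t Ht. unfold frullani_integrand.
    rewrite Cmod_div; [|apply RtoC_neq_0; lra]. rewrite Cmod_R Rabs_pos_eq; [|lra].
    apply Rle_div_l; [lra|].
    eapply Rle_trans; [apply (cexpm_diff_bound (RtoC 1) z b)|]; simpl; try lra.
  - rewrite RtoC_mult. apply improper_ext with (2 := improper_scal _ _ _ (improper_pow_exp b 0 Hb)).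
    intros t _. rewrite -RtoC_mult. reflexivity.
  - exists v; exact Hv.
Qed.

Definition frullani (z : C) : C := epsilon (inhabits (RtoC 0)) (improper (frullani_integrand z)).

Lemma frullani_spec (z : C) : 0 < Re z -> improper (frullani_integrand z) (frullani z).
Proof. intros Hz. exact (epsilon_spec (inhabits (RtoC 0)) _ (frullani_exists z Hz)). Qed.

(* Frullani's integral is differentiable in [z] with derivative [-1/z]. *)
Lemma frullani_taylor (z z' : C) (b : R) :
  0 < b -> b <= Re z -> b <= Re z' ->
  Cmod (Cplus (Cminus (frullani z') (frullani z)) (Cmult (Cminus z' z) (Cinv z))) <=
    Cmod (Cminus z' z) ^ 2 / b ^ 2.
Proof.
  intros Hb Hz Hz'.
  assert (H := improper_plus _ _ _ _
    (improper_minus _ _ _ _ (frullani_spec z' ltac:(lra)) (frullani_spec z ltac:(lra)))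
    (improper_scal (Cminus z' z) _ _ (improper_cexpm z ltac:(lra)))).
  destruct (improper_dominated
    (fun t => Cplus (Cminus (frullani_integrand z' t) (frullani_integrand z t)) (Cmult (Cminus z' z) (cexpm z t)))
    (fun t => Cmod (Cminus z' z) ^ 2 * (t ^ 1 * exp (- (b * t))))
    (Cmod (Cminus z' z) ^ 2 * (INR (fact 1) / b ^ 2))) as [v [Hv Hle]].
  - intros t Ht. destruct H as (_ & _ & _ & _ & H & _). apply H, Ht.
  - intros t Ht. unfold frullani_integrand.
    assert (Ht0 : RtoC t <> RtoC 0) by (apply RtoC_neq_0; lra).
    replace (Cplus _ _) with
      (Cdiv (Cminus (Cminus (cexpm z' t) (cexpm z t))
         (Cmult (Cminus (Copp (Cmult z' (RtoC t))) (Copp (Cmult z (RtoC t)))) (cexpm z t))) (RtoC t))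
      by (field; exact Ht0).
    rewrite Cmod_div; [|exact Ht0]. rewrite Cmod_R Rabs_pos_eq; [|lra].
    apply Rle_div_l; [lra|].
    eapply Rle_trans; [apply (Cexp_taylor2 _ _ (- (b * t)))|].
    + replace (Re (Copp (Cmult z (RtoC t)))) with (- (Re z * t)) by Rring. nra.
    + replace (Re (Copp (Cmult z' (RtoC t)))) with (- (Re z' * t)) by Rring. nra.
    + right. replace (Cminus _ _) with (Copp (Cmult (Cminus z' z) (RtoC t))) by ring.
      rewrite Cmod_opp Cmod_mult Cmod_R Rabs_pos_eq; [ring | lra].
  - rewrite RtoC_mult. apply improper_ext with (2 := improper_scal _ _ _ (improper_pow_exp b 1 Hb)).
    intros t _. rewrite -RtoC_mult. reflexivity.
  - rewrite (improper_unique _ _ _ H Hv). eapply Rle_trans; [exact Hle|].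
    right; simpl; field; lra.
Qed.

Lemma Cmod_pos_Re (z : C) : 0 < Re z -> 0 < Cmod z.
Proof. intros H. apply Cmod_gt_0, Re_pos_neq_0, H. Qed.

(** The definition of [Arg] splits on the sign of the imaginary part; in the right half-plane this
    form is smooth across the real axis, so that [Clog] can be differentiated. *)
Lemma Arg_atan (z : C) : 0 < Re z -> Arg z = atan (Im z / Re z).
Proof.
  intros Hz. assert (Hm := Cmod_pos_Re z Hz).
  assert (Hsq : Cmod z * Cmod z = Re z * Re z + Im z * Im z)
    by (generalize (Cmod2_alt z); simpl; lra).
  assert (H : acos (Re z / Cmod z) = atan (Rabs (Im z) / Re z)).
  { rewrite acos_atan; [|apply Rdiv_lt_0_compat; assumption]. f_equal.
    replace (1 - (Re z / Cmod z)²) with ((Rabs (Im z) / Cmod z)²).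
    - rewrite sqrt_Rsqr; [field; lra|]. apply Rmult_le_pos; [apply Rabs_pos|].
      apply Rlt_le, Rinv_0_lt_compat, Hm.
    - assert (Ha : Rabs (Im z) * Rabs (Im z) = Im z * Im z)
        by (rewrite -Rabs_mult; apply Rabs_pos_eq, Rle_0_sqr).
      unfold Rsqr. replace (Rabs (Im z) / Cmod z * (Rabs (Im z) / Cmod z)) with
        (Rabs (Im z) * Rabs (Im z) / (Cmod z * Cmod z)) by (field; lra).
      replace (Re z / Cmod z * (Re z / Cmod z)) with (Re z * Re z / (Cmod z * Cmod z)) by (field; lra).
      rewrite Ha Hsq. field. nra. }
  unfold Arg. rewrite H. destruct (Rle_dec 0 (Im z)) as [Hi|Hi].
  - rewrite Rabs_pos_eq; auto.
  - rewrite Rabs_left; [|lra]. replace (- Im z / Re z) with (- (Im z / Re z)) by (field; lra).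
    rewrite atan_opp Ropp_involutive. reflexivity.
Qed.

Lemma Clog_RtoC (x : R) : 0 < x -> Clog (RtoC x) = RtoC (ln x).
Proof.
  intros Hx. unfold Clog. rewrite Cmod_R Rabs_pos_eq; [|lra]. rewrite Arg_atan //.
  simpl. replace (0 / x) with 0 by (field; lra). rewrite atan_0. reflexivity.
Qed.

(** The segment from 1 to [z]: it turns dependence on a complex parameter into dependence on the
    real parameter [u]. *)
Definition cpath (z : C) (u : R) : C := Cplus (RtoC 1) (Cmult (Cminus z (RtoC 1)) (RtoC u)).

Lemma Re_cpath (z : C) (u : R) : Re (cpath z u) = 1 + (Re z - 1) * u.
Proof. unfold cpath; Rring. Qed.

Lemma Im_cpath (z : C) (u : R) : Im (cpath z u) = Im z * u.
Proof. unfold cpath; Rring. Qed.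

Lemma Cderiv_Clog_cpath (z : C) (u : R) :
  0 < Re (cpath z u) ->
  Cderiv (fun v => Clog (cpath z v)) u (Cmult (Cminus z (RtoC 1)) (Cinv (cpath z u))).
Proof.
  intros Hu. assert (Hu' := Hu). rewrite Re_cpath in Hu'.
  assert (Hloc : locally u (fun v => 0 < 1 + (Re z - 1) * v)).
  { assert (Hc : continuous (fun v => 1 + (Re z - 1) * v) u)
      by (apply: ex_derive_continuous; auto_derive; exact I).
    apply (Hc (fun y => 0 < y)). apply (open_gt 0), Hu'. }
  apply Cderiv_ext_loc with (f := fun v =>
     (ln (sqrt ((1 + (Re z - 1) * v) ^ 2 + (Im z * v) ^ 2)), atan (Im z * v / (1 + (Re z - 1) * v))) : C).
  - revert Hloc; apply filter_imp; intros v Hv. unfold Clog.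
    rewrite Arg_atan Re_cpath // Im_cpath. unfold Cmod.
    rewrite -/(Re (cpath z v)) -/(Im (cpath z v)) Re_cpath Im_cpath. reflexivity.
  - assert (Hpos : 0 < (1 + (Re z - 1) * u) ^ 2 + (Im z * u) ^ 2) by nra.
    split; simpl.
    + auto_derive.
      * repeat split; [simpl in Hpos; lra | apply sqrt_lt_R0; simpl in Hpos; lra].
      * set (s := sqrt _). assert (Hs : s * s = (1 + (Re z - 1) * u) ^ 2 + (Im z * u) ^ 2)
          by (unfold s; rewrite sqrt_sqrt; simpl; simpl in Hpos; lra).
        assert (Hs0 : s <> 0) by (intros E; rewrite E in Hs; lra).
        match goal with |- ?X * / (2 * s) * / s = _ =>
          replace (X * / (2 * s) * / s) with (X / (2 * (s * s))) by (field; exact Hs0) end.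
        rewrite Hs. unfold Re, Im in *. field. nra.
    + auto_derive.
      * lra.
      * unfold Re, Im in *. field. repeat split; nra.
Qed.

(** This allows differentiation under the integral sign without a general theorem: [frullani_taylor]
    provides exactly such a quadratic remainder. *)
Lemma Cderiv_of_quadratic (F : R -> C) (u M : R) (l : C) :
  0 <= M ->
  locally u (fun v => Cmod (Cminus (Cminus (F v) (F u)) (Cmult l (RtoC (v - u)))) <= M * (v - u) ^ 2) ->
  Cderiv F u l.
Proof.
  intros HM H.
  assert (Hreal : forall (f : R -> R) (m : R),
    locally u (fun v => Rabs (f v - f u - m * (v - u)) <= M * (v - u) ^ 2) -> is_derive f u m).
  { intros f m Hf. apply is_derive_Reals. intros eps Heps.
    destruct Hf as [d Hd].
    (* The radius uses [M + 1] because [M] may be 0. *)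
    assert (Hd2 : 0 < Rmin d (eps / (M + 1))).
    { apply Rmin_glb_lt; [apply cond_pos | apply Rdiv_lt_0_compat; lra]. }
    exists (mkposreal _ Hd2). intros h Hh0 Hh. simpl in Hh.
    assert (Hb := Hd (u + h)). replace (u + h - u) with h in Hb by ring.
    assert (Hball : ball u d (u + h)).
    { cbn; unfold AbsRing_ball, abs, minus, plus, opp; cbn.
      replace (u + h + - u) with h by ring.
      eapply Rlt_le_trans; [exact Hh | apply Rmin_l]. }
    specialize (Hb Hball).
    replace ((f (u + h) - f u) / h - m) with ((f (u + h) - f u - m * h) * / h) by (field; exact Hh0).
    assert (Hah : 0 < Rabs h) by (apply Rabs_pos_lt, Hh0).
    rewrite Rabs_mult Rabs_inv. rewrite -(pow2_abs h) in Hb.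
    apply Rle_lt_trans with (M * Rabs h).
    - apply (Rmult_le_reg_r (Rabs h)); [exact Hah|].
      rewrite Rmult_assoc Rinv_l; [|lra]. simpl in Hb; lra.
    - apply Rlt_le_trans with ((M + 1) * (eps / (M + 1))); [|right; field; lra].
      assert (Rabs h < eps / (M + 1)) by (eapply Rlt_le_trans; [exact Hh | apply Rmin_r]).
      nra. }
  split; apply Hreal; revert H; apply filter_imp; intros v Hv; eapply Rle_trans; [|exact Hv| |exact Hv].
  - eapply Rle_trans; [|apply re_le_Cmod]. right; f_equal. Rring.
  - eapply Rle_trans; [|apply (Rle_trans _ _ _ (Rmax_r _ _) (Rmax_Cmod _))]. right; f_equal. Rring.
Qed.

(** Along the segment from 1 to [z] the derivatives of [frullani] and [Clog] cancel, and both
    functions vanish at 1. *)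
Lemma frullani_value (z : C) : 0 < Re z -> frullani z = Copp (Clog z).
Proof.
  intros Hz.
  set (H := fun u => Cplus (frullani (cpath z u)) (Clog (cpath z u))).
  assert (Hconst : H 1 = H 0).
  { apply Cderiv_zero_const; [lra|]. intros u Hu.
    assert (Hpos : 0 < Re (cpath z u)) by (rewrite Re_cpath; nra).
    apply Cderiv_eq with (l := Cplus (Copp (Cmult (Cminus z (RtoC 1)) (Cinv (cpath z u))))
        (Cmult (Cminus z (RtoC 1)) (Cinv (cpath z u)))); [|ring].
    apply Cderiv_plus; [|apply Cderiv_Clog_cpath, Hpos].
    (* Half of the real part at [u] bounds the real parts from below at all nearby points, so the
       remainder constant is uniform there. *)
    set (b := Re (cpath z u) / 2). assert (Hb : 0 < b) by (unfold b; lra).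
    apply Cderiv_of_quadratic with (M := Cmod (Cminus z (RtoC 1)) ^ 2 / b ^ 2).
    - apply Rmult_le_pos; [apply pow2_ge_0 | apply Rlt_le, Rinv_0_lt_compat, pow_lt, Hb].
    - assert (Hloc : locally u (fun v => b < Re (cpath z v))).
      { assert (Hc : continuous (fun v => 1 + (Re z - 1) * v) u)
          by (apply: ex_derive_continuous; auto_derive; exact I).
        assert (Hl : locally u (fun v => b < 1 + (Re z - 1) * v)).
        { apply (Hc (fun y => b < y)). apply (open_gt b). rewrite -Re_cpath. unfold b; lra. }
        revert Hl; apply filter_imp; intros v; rewrite Re_cpath; auto. }
      revert Hloc; apply filter_imp; intros v Hv.
      assert (HT := frullani_taylor (cpath z u) (cpath z v) b Hb ltac:(unfold b; lra) ltac:(lra)).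
      assert (E : Cminus (cpath z v) (cpath z u) = Cmult (Cminus z (RtoC 1)) (RtoC (v - u)))
        by (unfold cpath; rewrite RtoC_minus; ring).
      rewrite E Cmod_mult Cmod_R Rpow_mult_distr pow2_abs in HT.
      replace (Cminus _ _) with (Cplus (Cminus (frullani (cpath z v)) (frullani (cpath z u)))
        (Cmult (Cmult (Cminus z (RtoC 1)) (RtoC (v - u))) (Cinv (cpath z u)))) by ring.
      eapply Rle_trans; [exact HT|]. right; field; lra. }
  assert (H1 : frullani (RtoC 1) = RtoC 0).
  { apply improper_unique with (1 := frullani_spec (RtoC 1) Rlt_0_1).
    apply improper_ext with (f := fun t => Cmult (RtoC 0) (cexpm (RtoC 1) t)).
    - intros t Ht. unfold frullani_integrand. field. apply RtoC_neq_0; lra.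
    - rewrite -[X in improper _ X](Cmult_0_l (Cinv (RtoC 1))). apply improper_scal, improper_cexpm, Rlt_0_1. }
  unfold H in Hconst.
  replace (cpath z 1) with z in Hconst by (unfold cpath; ring).
  replace (cpath z 0) with (RtoC 1) in Hconst by (unfold cpath; ring).
  rewrite H1 Clog_RtoC in Hconst; [|lra]. rewrite ln_1 in Hconst.
  replace (frullani z) with (Cminus (Cplus (frullani z) (Clog z)) (Clog z)) by ring.
  rewrite Hconst; ring.
Qed.

(** * Taylor quotients and asymptotic series at 0 *)

Definition seq_tail (a : nat -> C) : nat -> C := fun i => a (S i).

(* [jet_rem a k t x = (x - sum_(i < k) a_i t^i) / t^k] for [t <> 0]. *)
Fixpoint jet_rem (a : nat -> C) (k : nat) (t x : C) : C :=
  match k with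
  | O => x
  | S k => jet_rem (seq_tail a) k t (Cdiv (Cminus x (a O)) t)
  end.

(* The [n]-th Taylor quotient, damped by [e^(-t)] in its top coefficient so as to be
   integrable at both 0 and infinity. *)
Definition reg_quot (n : nat) (a : nat -> C) (t x : C) : C :=
  Cdiv (Cminus (jet_rem a n t x) (Cmult (a n) (Cexp (Copp t)))) t.

(* The recursion follows [f g = a_0 g + t ((f - a_0)/t) g], which lets the statements about
   products be proved by induction without finite sums. *)
Fixpoint cauchy_prod (a b : nat -> C) (k : nat) : C :=
  match k with
  | O => Cmult (a O) (b O)
  | S k' => Cplus (Cmult (a O) (b k)) (cauchy_prod (seq_tail a) b k')
  end.

(** Long division by a series with [b_0 = 1]: [f/g = a_0 + t h/g] with [h = (f - a_0 g)/t], and the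
    coefficients of [h] are the [a_(i+1) - a_0 b_(i+1)]. *)
Fixpoint cauchy_quot (a b : nat -> C) (k : nat) : C :=
  match k with
  | O => a O
  | S k => cauchy_quot (fun i => Cminus (a (S i)) (Cmult (a O) (b (S i)))) b k
  end.

(** The definition removes the lowest coefficient first; this form exposes the highest one, as
    inductions on the order require. *)
Lemma jet_rem_S (a : nat -> C) (k : nat) (t x : C) :
  jet_rem a (S k) t x = Cdiv (Cminus (jet_rem a k t x) (a k)) t.
Proof.
  revert a x; induction k as [|k IH]; intros a x; [reflexivity|].
  change (jet_rem a (S (S k)) t x) with (jet_rem (seq_tail a) (S k) t (Cdiv (Cminus x (a O)) t)).
  rewrite IH. reflexivity.
Qed.

Lemma jet_rem_ext (a b : nat -> C) (k : nat) (t x : C) :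
  (forall i, (i < k)%nat -> a i = b i) -> jet_rem a k t x = jet_rem b k t x.
Proof.
  induction k as [|k IH]; intros H; [reflexivity|].
  rewrite !jet_rem_S IH; [rewrite H; [reflexivity | lia]|]. intros; apply H; lia.
Qed.

Lemma jet_rem_plus (a b : nat -> C) (k : nat) (t x y : C) :
  jet_rem (fun i => Cplus (a i) (b i)) k t (Cplus x y) = Cplus (jet_rem a k t x) (jet_rem b k t y).
Proof.
  induction k as [|k IH]; [reflexivity|]. rewrite !jet_rem_S IH. unfold Cdiv; ring.
Qed.

Lemma jet_rem_scal (c : C) (a : nat -> C) (k : nat) (t x : C) :
  jet_rem (fun i => Cmult c (a i)) k t (Cmult c x) = Cmult c (jet_rem a k t x).
Proof.
  induction k as [|k IH]; [reflexivity|]. rewrite !jet_rem_S IH. unfold Cdiv; ring.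
Qed.

Lemma jet_rem_minus (a b : nat -> C) (k : nat) (t x y : C) :
  jet_rem (fun i => Cminus (a i) (b i)) k t (Cminus x y) = Cminus (jet_rem a k t x) (jet_rem b k t y).
Proof.
  induction k as [|k IH]; [reflexivity|]. rewrite !jet_rem_S IH. unfold Cdiv; ring.
Qed.

Lemma jet_rem_cauchy_prod (a b : nat -> C) (k : nat) (t x y : C) :
  jet_rem (cauchy_prod a b) (S k) t (Cmult x y) =
    Cplus (Cmult (a O) (jet_rem b (S k) t y))
          (jet_rem (cauchy_prod (seq_tail a) b) k t (Cmult (Cdiv (Cminus x (a O)) t) y)).
Proof.
  change (jet_rem b (S k) t y) with (jet_rem (seq_tail b) k t (Cdiv (Cminus y (b O)) t)).
  rewrite -jet_rem_scal -jet_rem_plus.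
  change (jet_rem (cauchy_prod a b) (S k) t (Cmult x y)) with
    (jet_rem (seq_tail (cauchy_prod a b)) k t (Cdiv (Cminus (Cmult x y) (Cmult (a O) (b O))) t)).
  f_equal. unfold Cdiv; ring.
Qed.

(** In [x y = a_0 y + t ((x - a_0)/t) y] the factor [t] lowers the order of the second quotient by
    one. The top coefficients add up likewise, so the damping terms match. *)
Lemma reg_quot_cauchy_prod_S (a b : nat -> C) (n : nat) (t x y : C) :
  reg_quot (S n) (cauchy_prod a b) t (Cmult x y) =
    Cplus (Cmult (a O) (reg_quot (S n) b t y))
          (reg_quot n (cauchy_prod (seq_tail a) b) t (Cmult (Cdiv (Cminus x (a O)) t) y)).
Proof.
  unfold reg_quot. rewrite jet_rem_cauchy_prod. cbn [cauchy_prod]. unfold Cdiv; ring.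
Qed.

(** At order 0 the second product needs no regularisation; for [y = e^(-st)] it is the integrand of
    a Laplace transform. *)
Lemma reg_quot_cauchy_prod_O (a b : nat -> C) (t x y : C) :
  reg_quot O (cauchy_prod a b) t (Cmult x y) =
    Cplus (Cmult (a O) (reg_quot O b t y)) (Cmult (Cdiv (Cminus x (a O)) t) y).
Proof. unfold reg_quot; simpl. unfold Cdiv; ring. Qed.

(* [f] has the asymptotic Taylor series [a] at [0+]. *)
Definition jet (f : R -> C) (a : nat -> C) : Prop :=
  forall k, exists B, forall t, 0 < t <= 1 -> Cmod (jet_rem a k (RtoC t) (f t)) <= B.

Lemma jet_ext (f g : R -> C) (a b : nat -> C) :
  (forall t, 0 < t <= 1 -> f t = g t) -> (forall i, a i = b i) -> jet f a -> jet g b.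
Proof.
  intros H H' Hf k. destruct (Hf k) as [B HB]. exists B. intros t Ht.
  rewrite -H // -(jet_rem_ext a); auto.
Qed.

Lemma jet_minus (f g : R -> C) (a b : nat -> C) :
  jet f a -> jet g b -> jet (fun t => Cminus (f t) (g t)) (fun i => Cminus (a i) (b i)).
Proof.
  intros Hf Hg k. destruct (Hf k) as [B HB], (Hg k) as [B' HB']. exists (B + B'). intros t Ht.
  rewrite jet_rem_minus. eapply Rle_trans; [apply Cmod_triangle|]. rewrite Cmod_opp.
  apply Rplus_le_compat; auto.
Qed.

Lemma jet_scal (c : C) (f : R -> C) (a : nat -> C) :
  jet f a -> jet (fun t => Cmult c (f t)) (fun i => Cmult c (a i)).
Proof.
  intros Hf k. destruct (Hf k) as [B HB]. exists (Cmod c * B). intros t Ht.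
  rewrite jet_rem_scal Cmod_mult. apply Rmult_le_compat_l; [apply Cmod_ge_0 | auto].
Qed.

Lemma jet_tail (f : R -> C) (a : nat -> C) :
  jet f a -> jet (fun t => Cdiv (Cminus (f t) (a O)) (RtoC t)) (seq_tail a).
Proof. intros Hf k. exact (Hf (S k)). Qed.

Definition seq_cons (x : C) (a : nat -> C) (i : nat) : C :=
  match i with O => x | S i => a i end.

Lemma jet_rem_cons_0 (a : nat -> C) (k : nat) (t x : C) :
  t <> RtoC 0 -> jet_rem (seq_cons (RtoC 0) a) (S k) t (Cmult t x) = jet_rem a k t x.
Proof.
  intros Ht. cbn [jet_rem seq_cons].
  replace (Cdiv (Cminus (Cmult t x) (RtoC 0)) t) with x by (field; exact Ht). reflexivity.
Qed.

Lemma jet_cons_0 (f : R -> C) (a : nat -> C) :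
  jet f a -> jet (fun t => Cmult (RtoC t) (f t)) (seq_cons (RtoC 0) a).
Proof.
  intros Hf [|k].
  - destruct (Hf O) as [B HB]. exists B. intros t Ht. cbn [jet_rem]. rewrite Cmod_mult Cmod_R.
    specialize (HB t Ht). cbn [jet_rem] in HB. rewrite Rabs_pos_eq; [|lra].
    generalize (Cmod_ge_0 (f t)); nra.
  - destruct (Hf k) as [B HB]. exists B. intros t Ht.
    rewrite jet_rem_cons_0; [auto | apply RtoC_neq_0; lra].
Qed.

Lemma jet_mult (f g : R -> C) (a b : nat -> C) :
  jet f a -> jet g b -> jet (fun t => Cmult (f t) (g t)) (cauchy_prod a b).
Proof.
  intros Hf Hg k. revert f a Hf; induction k as [|k IH]; intros f a Hf.
  - destruct (Hf O) as [B HB], (Hg O) as [B' HB']. exists (B * B'). intros t Ht.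
    cbn [jet_rem]. rewrite Cmod_mult. specialize (HB t Ht); specialize (HB' t Ht). cbn [jet_rem] in *.
    apply Rmult_le_compat; auto; apply Cmod_ge_0.
  - destruct (IH _ _ (jet_tail _ _ Hf)) as [B HB]. destruct (Hg (S k)) as [B' HB'].
    exists (Cmod (a O) * B' + B). intros t Ht. rewrite jet_rem_cauchy_prod.
    eapply Rle_trans; [apply Cmod_triangle|]. apply Rplus_le_compat; auto.
    rewrite Cmod_mult. apply Rmult_le_compat_l; [apply Cmod_ge_0 | auto].
Qed.

Lemma jet_cauchy_quot (f g : R -> C) (a b : nat -> C) (M : R) :
  (forall t, 0 < t <= 1 -> g t <> RtoC 0 /\ Cmod (Cinv (g t)) <= M) -> b O = RtoC 1 ->
  jet f a -> jet g b -> jet (fun t => Cdiv (f t) (g t)) (cauchy_quot a b).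
Proof.
  intros HM Hb Hf Hg k. revert f a Hf; induction k as [|k IH]; intros f a Hf.
  - destruct (Hf O) as [B HB]. exists (B * M). intros t Ht.
    cbn [jet_rem]. unfold Cdiv. rewrite Cmod_mult. specialize (HB t Ht). cbn [jet_rem] in *.
    apply Rmult_le_compat; auto; try apply Cmod_ge_0. apply HM, Ht.
  (* Since [b_0 = 1], the function [f - a_0 g] has constant coefficient 0, so its tail is the next
     numerator of the long division. *)
  - assert (H := jet_tail _ _ (jet_minus _ _ _ _ Hf (jet_scal (a O) _ _ Hg))).
    destruct (IH _ _ H) as [B HB]. exists B. intros t Ht.
    assert (Ht0 : RtoC t <> RtoC 0) by (apply RtoC_neq_0; lra).
    destruct (HM t Ht) as [Hg0 _].
    eapply Rle_trans; [|apply (HB t Ht)]. right; f_equal.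
    cbn [jet_rem cauchy_quot]. unfold seq_tail at 1. f_equal. rewrite Hb. field; auto.
Qed.

Lemma small_zero (x M : R) : 0 <= x -> (forall t, 0 < t <= 1 -> x <= M * t) -> x = 0.
Proof.
  intros Hx H. destruct (Rle_lt_or_eq_dec 0 x Hx) as [Hx'|]; [|auto]. exfalso.
  assert (HM : 0 < M) by (generalize (H 1 ltac:(lra)); lra).
  assert (Ht : 0 < Rmin 1 (x / (2 * M)))
    by (apply Rmin_glb_lt; [lra | apply Rdiv_lt_0_compat; lra]).
  assert (H1 := H _ (conj Ht (Rmin_l _ _))).
  assert (H2 : M * Rmin 1 (x / (2 * M)) <= M * (x / (2 * M)))
    by (apply Rmult_le_compat_l; [lra | apply Rmin_r]).
  replace (M * (x / (2 * M))) with (x / 2) in H2 by (field; lra). lra.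
Qed.

(** Once the lower coefficients agree, [a_k - b_k] is [t] times a bounded function. Identities
    between functions thereby give identities between coefficients. *)
Lemma jet_unique (f : R -> C) (a b : nat -> C) : jet f a -> jet f b -> forall k, a k = b k.
Proof.
  intros Ha Hb k. induction k as [k IH] using (well_founded_induction Wf_nat.lt_wf).
  destruct (Ha (S k)) as [B HB], (Hb (S k)) as [B' HB'].
  apply Ceq_minus, Cmod_eq_0, small_zero with (M := B + B'); [apply Cmod_ge_0|].
  intros t Ht. assert (Ht0 : RtoC t <> RtoC 0) by (apply RtoC_neq_0; lra).
  specialize (HB t Ht); specialize (HB' t Ht). rewrite !jet_rem_S in HB, HB'.
  rewrite (jet_rem_ext a b) in HB; [|exact IH]. set (r := jet_rem b k _ _) in *.
  replace (Cminus (a k) (b k)) with (Cmult (Cminus (Cdiv (Cminus r (b k)) (RtoC t)) (Cdiv (Cminus r (a k)) (RtoC t))) (RtoC t))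
    by (field; exact Ht0).
  rewrite Cmod_mult Cmod_R Rabs_pos_eq; [|lra]. apply Rmult_le_compat_r; [lra|].
  eapply Rle_trans; [apply Cmod_triangle|]. rewrite Cmod_opp. lra.
Qed.

(** * Taylor expansion of the exponential *)

Definition exp_coef (z : C) (i : nat) : C := Cdiv (Cpow (Copp z) i) (RtoC (INR (fact i))).

Lemma INR_S_neq (n : nat) : RtoC (INR (S n)) <> RtoC 0.
Proof. apply RtoC_neq_0, not_0_INR; lia. Qed.

Lemma fact_neq (n : nat) : RtoC (INR (fact n)) <> RtoC 0.
Proof. apply RtoC_neq_0, INR_fact_neq_0. Qed.

Lemma exp_coef_O (z : C) : exp_coef z O = RtoC 1.
Proof. unfold exp_coef; simpl. field. Qed.

Lemma exp_coef_S (z : C) (n : nat) :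
  exp_coef z (S n) = Cdiv (Cmult (Copp z) (exp_coef z n)) (RtoC (INR (S n))).
Proof.
  unfold exp_coef. rewrite Cpow_S fact_simpl mult_INR RtoC_mult. field.
  split; [apply fact_neq | apply INR_S_neq].
Qed.

(** The numerator of [jet_rem (exp_coef z) k], kept undivided because differentiation then simply
    lowers the order by one. *)
Fixpoint taylor_rem (z : C) (k : nat) (t : R) : C :=
  match k with
  | O => cexpm z t
  | S k => Cminus (taylor_rem z k t) (Cmult (exp_coef z k) (RtoC (t ^ k)))
  end.

Lemma Cderiv_taylor_rem (z : C) (k : nat) (t : R) :
  Cderiv (taylor_rem z (S k)) t (Cmult (Copp z) (taylor_rem z k t)).
Proof.
  induction k as [|k IH].
  - eapply Cderiv_eq.
    + apply Cderiv_minus; [apply Cderiv_cexpm | apply (Cderiv_const (Cmult (exp_coef z 0) (RtoC 1)))].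
    + cbn [taylor_rem]. ring.
  - eapply Cderiv_eq.
    + apply Cderiv_minus; [exact IH|].
      apply Cderiv_scal, Cderiv_RtoC. apply (is_derive_pow (fun t => t)). apply (is_derive_id (K := R_AbsRing)).
    + cbn [taylor_rem Init.Nat.pred]. rewrite exp_coef_S !RtoC_mult. unfold one; simpl (AbsRing.sort _). cbn.
      field. apply INR_S_neq.
Qed.

Lemma Ccont_taylor_rem (z : C) (k : nat) (t : R) : Ccont (taylor_rem z k) t.
Proof.
  destruct k; [apply Ccont_cexpm | exact (Cderiv_cont _ _ _ (Cderiv_taylor_rem z k t))].
Qed.

Lemma taylor_rem_0 (z : C) (k : nat) : taylor_rem z (S k) 0 = RtoC 0.
Proof.
  induction k as [|k IH].
  - cbn [taylor_rem]. rewrite exp_coef_O. unfold cexpm. rewrite Cmult_0_r Copp_0 Cexp_RtoC exp_0.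
    simpl pow; ring.
  - change (Cminus (taylor_rem z (S k) 0) (Cmult (exp_coef z (S k)) (RtoC (0 ^ S k))) = RtoC 0).
    rewrite IH pow_i; [ring | lia].
Qed.

(** Integrating from 0 raises the order by one, starting from [Cmod (e^(-zt)) <= 1]. As [0 <= Re z],
    the bound holds on the whole half-line and serves at both ends. *)
Lemma taylor_rem_bound (z : C) (k : nat) (t : R) :
  0 <= Re z -> 0 <= t -> Cmod (taylor_rem z k t) <= Cmod z ^ k / INR (fact k) * t ^ k.
Proof.
  intros Hz. revert t; induction k as [|k IH]; intros t Ht.
  - cbn [taylor_rem]. rewrite Cmod_cexpm. simpl.
    apply Rle_trans with 1; [|right; field]. apply exp_neg_le_1. nra.
  - replace (taylor_rem z (S k) t) with (Cminus (taylor_rem z (S k) t) (taylor_rem z (S k) 0))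
      by (rewrite taylor_rem_0; ring).
    eapply Rle_trans.
    + apply (Cderiv_bound (taylor_rem z (S k)) (fun t => Cmult (Copp z) (taylor_rem z k t))
        (fun t => Cmod z ^ S k / INR (fact (S k)) * t ^ S k)
        (fun t => Cmod z * (Cmod z ^ k / INR (fact k) * t ^ k)) 0 t Ht).
      * intros u _; apply Cderiv_taylor_rem.
      * intros u _; apply Ccont_mult; [apply Ccont_const | apply Ccont_taylor_rem].
      * intros u _. evar_last.
        -- apply (is_derive_scal (fun t => t ^ S k) u (Cmod z ^ S k / INR (fact (S k)))).
           apply (is_derive_pow (fun t => t)). apply (is_derive_id (K := R_AbsRing)).
        -- unfold one; cbn [Init.Nat.pred]. rewrite fact_simpl mult_INR.
           unfold scal; simpl scal; unfold mult. cbn -[INR fact pow].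
           cbn [pow]. field. split; [apply INR_fact_neq_0 | apply not_0_INR; lia].
      * intros u _. apply: ex_derive_continuous. auto_derive. exact I.
      * intros u Hu. rewrite Cmod_mult Cmod_opp. apply Rmult_le_compat_l; [apply Cmod_ge_0|].
        apply IH; lra.
    + rewrite (pow_i (S k)); [|lia]. right; ring.
Qed.

Lemma jet_rem_cexpm (z : C) (k : nat) (t : R) :
  0 < t -> jet_rem (exp_coef z) k (RtoC t) (cexpm z t) = Cmult (taylor_rem z k t) (RtoC (/ t ^ k)).
Proof.
  intros Ht. assert (Ht0 : RtoC t <> RtoC 0) by (apply RtoC_neq_0; lra).
  induction k as [|k IH].
  - simpl. rewrite Rinv_1. ring.
  - assert (Hk : t ^ k <> 0) by (apply pow_nonzero; lra).
    rewrite jet_rem_S IH. cbn [taylor_rem pow].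
    rewrite !RtoC_inv ?RtoC_mult; [field; split; auto; apply RtoC_neq_0, Hk | | exact Hk].
    apply Rmult_integral_contrapositive; split; [lra | exact Hk].
Qed.

Lemma jet_cexpm (z : C) : 0 <= Re z -> jet (cexpm z) (exp_coef z).
Proof.
  intros Hz k. exists (Cmod z ^ k / INR (fact k)). intros t Ht.
  assert (Hp : 0 < t ^ k) by (apply pow_lt; lra).
  rewrite jet_rem_cexpm; [|lra]. rewrite Cmod_mult Cmod_R Rabs_pos_eq; [|apply Rlt_le, Rinv_0_lt_compat, Hp].
  apply Rle_div_l; [exact Hp|]. apply taylor_rem_bound; lra.
Qed.

(** * Frullani's formula at higher order *)

Fixpoint harmonic (n : nat) : R :=
  match n with O => 0 | S k => harmonic k + / INR (S k) end.

Lemma one_minus_exp_bound (t : R) : 0 <= t -> 0 <= 1 - exp (- t) <= t.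
Proof. intros Ht. generalize (exp_neg_le_1 t Ht) (exp_ineq1_le (- t)); lra. Qed.

Lemma Cexp_opp_RtoC (t : R) : Cexp (Copp (RtoC t)) = RtoC (exp (- t)).
Proof. rewrite -RtoC_opp. apply Cexp_RtoC. Qed.

Definition log_integral (n : nat) (z : C) : C :=
  Cmult (exp_coef z n) (Cminus (RtoC (harmonic n)) (Clog z)).

Lemma improper_reg_quot_cexpm (n : nat) (z : C) :
  0 < Re z ->
  improper (fun t => reg_quot n (exp_coef z) (RtoC t) (cexpm z t)) (log_integral n z).
Proof.
  intros Hz. unfold log_integral. induction n as [|n IH].
  - apply improper_ext with (f := frullani_integrand z).
    + intros t Ht. unfold reg_quot, frullani_integrand. cbn [jet_rem]. rewrite exp_coef_O Cexp_opp_RtoC cexpm_RtoC.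
      rewrite !Rmult_1_l Cmult_1_l. reflexivity.
    + replace (Cmult _ _) with (frullani z).
      * apply frullani_spec, Hz.
      * rewrite frullani_value // exp_coef_O. simpl harmonic. ring.
  - (* The primitive [- t reg_quot (S n) / (n + 1)] vanishes at both ends. *)
    set (p := exp_coef z (S n)). set (N := RtoC (INR (S n))).
    assert (HN : N <> RtoC 0) by apply INR_S_neq.
    assert (H : improper (fun t => Cminus (reg_quot (S n) (exp_coef z) (RtoC t) (cexpm z t))
       (Cmult (Cinv N) (Cplus (Cmult (Copp z) (reg_quot n (exp_coef z) (RtoC t) (cexpm z t))) (Cmult p (cexpm (RtoC 1) t)))))
       (RtoC 0)).
    { exists (fun t => Cmult (Copp (Cinv N)) (Cminus (Cmult (taylor_rem z (S n) t) (RtoC (/ t ^ S n))) (Cmult p (cexpm (RtoC 1) t)))).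
      exists (Cmult (Copp (Cinv N)) (RtoC 0)), (Cmult (Copp (Cinv N)) (RtoC 0)).
      split; [|split; [|split; [|split]]].
      - intros t Ht. assert (Ht0 : RtoC t <> RtoC 0) by (apply RtoC_neq_0; lra).
        assert (Htn : t ^ n <> 0) by (apply pow_nonzero; lra).
        eapply Cderiv_eq.
        + apply Cderiv_scal, Cderiv_minus; [|apply Cderiv_scal, Cderiv_cexpm].
          apply Cderiv_mult; [apply Cderiv_taylor_rem|]. apply Cderiv_RtoC.
          apply (is_derive_inv (fun t => t ^ S n) t).
          * apply (is_derive_pow (fun t => t)). apply (is_derive_id (K := R_AbsRing)).
          * apply pow_nonzero; lra.
        + unfold reg_quot. rewrite !jet_rem_cexpm // Cexp_opp_RtoC cexpm_RtoC Rmult_1_l.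
          fold p. unfold one; cbn [Init.Nat.pred]. cbn -[INR fact pow taylor_rem exp_coef].
          assert (Hp : exp_coef z n = Cmult (Copp (Cinv z)) (Cmult N p)).
          { unfold p. rewrite exp_coef_S -/N. field. split; [exact HN | apply Re_pos_neq_0, Hz]. }
          rewrite Hp. set (T := taylor_rem z (S n) t). set (T' := taylor_rem z n t).
          set (e := RtoC (exp (- t))).
          assert (E : RtoC (- (INR (S n) * 1 * t ^ n) / (t ^ S n) ^ 2) =
             Copp (Cdiv N (Cmult (RtoC (t ^ n)) (Cmult (RtoC t) (RtoC t))))).
          { unfold N. rewrite -!RtoC_mult -RtoC_div; [rewrite -RtoC_opp; f_equal; cbn [pow]; field; split; lra|].
            repeat apply Rmult_integral_contrapositive_currified; lra. }
          cbn [pow] in E |- *. rewrite E.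
          rewrite !Rinv_mult !RtoC_mult !RtoC_inv //; [|lra].
          assert (Hz0 := Re_pos_neq_0 z Hz). assert (HtC := RtoC_neq_0 _ Htn).
          field. repeat split; assumption.
      - intros t Ht. assert (Ht0 : RtoC t <> RtoC 0) by (apply RtoC_neq_0; lra).
        assert (Hreg : forall m, Ccont (fun t => reg_quot m (exp_coef z) (RtoC t) (cexpm z t)) t).
        { intros m.
          apply Ccont_ext_loc with (f := fun t => Cdiv (Cminus (Cmult (taylor_rem z m t) (RtoC (/ t ^ m))) (Cmult (exp_coef z m) (cexpm (RtoC 1) t))) (RtoC t)).
          - apply locally_pos; [exact Ht|]. intros u Hu. unfold reg_quot.
            rewrite jet_rem_cexpm // Cexp_opp_RtoC cexpm_RtoC Rmult_1_l. reflexivity.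
          - apply Ccont_div; [|apply Ccont_id_RtoC | exact Ht0].
            apply Ccont_minus; apply Ccont_mult; try apply Ccont_const; try apply Ccont_cexpm.
            + apply Ccont_taylor_rem.
            + apply Ccont_RtoC. apply: ex_derive_continuous. auto_derive.
              apply pow_nonzero; lra. }
        apply Ccont_minus; [apply Hreg|]. apply Ccont_mult; [apply Ccont_const|].
        apply Ccont_plus; (apply Ccont_mult; [apply Ccont_const|]); [apply Hreg | apply Ccont_cexpm].
      - apply (ctends_scal (at_right 0)).
        apply ctends_at_right_bound with (M := Cmod z ^ S (S n) / INR (fact (S (S n))) + Cmod p).
        intros t Ht. assert (Htn : 0 < t ^ S n) by (apply pow_lt; lra).
        (* Near 0 one more Taylor term is split off: the next remainder over [t^(n+1)] and
           [p (1 - e^(-t))] are both [O(t)]. *)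
        replace (Cminus _ _) with
          (Cplus (Cmult (taylor_rem z (S (S n)) t) (RtoC (/ t ^ S n))) (Cmult p (RtoC (1 - exp (- t))))).
        2: { cbn [taylor_rem]. rewrite -/(taylor_rem z (S n) t). fold p.
             rewrite cexpm_RtoC Rmult_1_l RtoC_minus RtoC_inv; [|lra]. field. apply RtoC_neq_0; lra. }
        eapply Rle_trans; [apply Cmod_triangle|]. rewrite Rmult_plus_distr_r.
        apply Rplus_le_compat.
        + rewrite Cmod_mult Cmod_R Rabs_pos_eq; [|apply Rlt_le, Rinv_0_lt_compat, Htn].
          apply Rle_div_l; [exact Htn|]. eapply Rle_trans; [apply taylor_rem_bound; lra|].
          right; simpl; ring.
        + rewrite Cmod_mult Cmod_R. destruct (one_minus_exp_bound t ltac:(lra)).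
          rewrite Rabs_pos_eq //. apply Rmult_le_compat_l; [apply Cmod_ge_0 | assumption].
      - apply (ctends_scal (Rbar_locally p_infty)).
        destruct (pow_exp_decay 1 0 Rlt_0_1) as [M HM].
        apply ctends_p_infty_bound with (M := (Cmod z ^ n / INR (fact n) + Cmod (exp_coef z n)) + Cmod p * M).
        intros t Ht. assert (Htn : 0 < t ^ n) by (apply pow_lt; lra).
        (* At infinity one Taylor term is put back: the remainder of order [n] over [t^n] is
           bounded, which leaves a factor [1/t]. *)
        replace (Cminus _ _) with
          (Cminus (Cmult (Cminus (Cmult (taylor_rem z n t) (RtoC (/ t ^ n))) (exp_coef z n)) (RtoC (/ t))) (Cmult p (cexpm (RtoC 1) t))).
        2: { cbn [taylor_rem pow]. rewrite Rinv_mult RtoC_mult !RtoC_inv; try lra. field. split; apply RtoC_neq_0; lra. }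
        eapply Rle_trans; [apply Cmod_triangle|]. rewrite Cmod_opp Cmod_mult (Cmod_mult p).
        unfold Rdiv at 1; rewrite Rmult_plus_distr_r. apply Rplus_le_compat.
        + rewrite Cmod_R Rabs_pos_eq; [|apply Rlt_le, Rinv_0_lt_compat; lra].
          apply Rmult_le_compat_r; [apply Rlt_le, Rinv_0_lt_compat; lra|].
          eapply Rle_trans; [apply Cmod_triangle|]. rewrite Cmod_opp.
          apply Rplus_le_compat_r. rewrite Cmod_mult Cmod_R Rabs_pos_eq; [|apply Rlt_le, Rinv_0_lt_compat; lra].
          apply Rle_div_l; [exact Htn|]. apply taylor_rem_bound; lra.
        + rewrite Rmult_assoc. apply Rmult_le_compat_l; [apply Cmod_ge_0|].
          rewrite Cmod_cexpm. specialize (HM t ltac:(lra)). simpl in *. lra.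
      - ring. }
    (* The integral of [p e^(-t)], divided by [n + 1], supplies the new summand of the harmonic
       number. *)
    assert (H2 := improper_plus _ _ _ _ H (improper_scal (Cinv N) _ _
       (improper_plus _ _ _ _ (improper_scal (Copp z) _ _ IH)
          (improper_scal p _ _ (improper_cexpm (RtoC 1) Rlt_0_1))))).
    replace (Cmult p _) with
      (Cplus (RtoC 0) (Cmult (Cinv N) (Cplus (Cmult (Copp z) (Cmult (exp_coef z n) (Cminus (RtoC (harmonic n)) (Clog z)))) (Cmult p (Cinv (RtoC 1)))))).
    + apply improper_ext with (2 := H2). intros t Ht. ring.
    + unfold p. rewrite exp_coef_S. cbn [harmonic]. fold N.
      rewrite RtoC_plus RtoC_inv; [|apply not_0_INR; lia]. fold N. field.
      exact HN.
Qed.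

(** * Laplace transforms *)

(** The hypothesis for Watson's lemma, with the Taylor quotients bounded on the whole half-line:
    every remainder is then a Laplace integral of a function of the same class. *)
Definition tame (f : R -> C) (a : nat -> C) : Prop :=
  (forall t, 0 < t -> Ccont f t) /\
  forall k, exists B, forall t, 0 < t -> Cmod (jet_rem a k (RtoC t) (f t)) <= B.

Definition divdiff (f : R -> C) (a : nat -> C) (t : R) : C := Cdiv (Cminus (f t) (a O)) (RtoC t).

(** Beyond [t = 1] the quotients stay bounded by themselves, since each new one subtracts a constant
    and divides by [t >= 1]. *)
Lemma tame_intro (f : R -> C) (a : nat -> C) (B : R) :
  (forall t, 0 < t -> Ccont f t) -> (forall t, 0 < t -> Cmod (f t) <= B) -> jet f a -> tame f a.
Proof.
  intros Hc Hb Hj; split; [exact Hc|]. induction k as [|k [B1 HB1]]; [exists B; exact Hb|].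
  destruct (Hj (S k)) as [B2 HB2]. exists (Rmax B2 (B1 + Cmod (a k))). intros t Ht.
  destruct (Rle_dec t 1) as [Ht1|Ht1].
  - eapply Rle_trans; [apply HB2; lra | apply Rmax_l].
  - eapply Rle_trans; [|apply Rmax_r]. rewrite jet_rem_S Cmod_div; [|apply RtoC_neq_0; lra].
    rewrite Cmod_R Rabs_pos_eq; [|lra]. apply Rle_div_l; [exact Ht|].
    eapply Rle_trans; [apply Cmod_triangle|]. rewrite Cmod_opp. specialize (HB1 t Ht).
    generalize (Cmod_ge_0 (a k)) (Cmod_ge_0 (jet_rem a k (RtoC t) (f t))); intros. nra.
Qed.

Lemma tame_divdiff (f : R -> C) (a : nat -> C) : tame f a -> tame (divdiff f a) (seq_tail a).
Proof.
  intros [Hc Hb]; split; [|intros k; exact (Hb (S k))].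
  intros t Ht. apply Ccont_div; [apply Ccont_minus; [auto | apply Ccont_const] | apply Ccont_id_RtoC |].
  apply RtoC_neq_0; lra.
Qed.

Definition moment_integrand (k : nat) (f : R -> C) (s t : R) : C :=
  Cmult (RtoC (t ^ k)) (Cmult (f t) (cexpm (RtoC s) t)).

Definition moment (k : nat) (f : R -> C) (s : R) : C :=
  epsilon (inhabits (RtoC 0)) (improper (moment_integrand k f s)).

Lemma moment_exists (k : nat) (f : R -> C) (B s : R) :
  (forall t, 0 < t -> Ccont f t) -> (forall t, 0 < t -> Cmod (f t) <= B) -> 0 < s ->
  exists v, improper (moment_integrand k f s) v /\ Cmod v <= B * (INR (fact k) / s ^ S k).
Proof.
  intros Hc Hb Hs.
  apply (improper_dominated _ (fun t => B * (t ^ k * exp (- (s * t))))).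
  - intros t Ht. apply Ccont_mult; [|apply Ccont_mult; [auto | apply Ccont_cexpm]].
    apply Ccont_RtoC. apply: ex_derive_continuous. auto_derive. exact I.
  - intros t Ht. unfold moment_integrand. rewrite Cmod_mult Cmod_mult Cmod_R Cmod_cexpm re_RtoC.
    rewrite Rabs_pos_eq; [|apply pow_le; lra].
    assert (H1 : 0 <= t ^ k) by (apply pow_le; lra).
    assert (H2 := exp_pos (- (s * t))). specialize (Hb t Ht).
    replace (B * _) with (t ^ k * (B * exp (- (s * t)))) by ring.
    apply Rmult_le_compat_l; [exact H1|]. apply Rmult_le_compat_r; lra.
  - rewrite RtoC_mult. apply improper_ext with (2 := improper_scal _ _ _ (improper_pow_exp s k Hs)).
    intros t _. rewrite -RtoC_mult. reflexivity.
Qed.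

Lemma moment_spec (k : nat) (f : R -> C) (a : nat -> C) (s : R) :
  tame f a -> 0 < s -> improper (moment_integrand k f s) (moment k f s).
Proof.
  intros [Hc Hb] Hs. destruct (Hb O) as [B HB].
  destruct (moment_exists k f B s Hc HB Hs) as [v [Hv _]].
  exact (epsilon_spec (inhabits (RtoC 0)) _ (ex_intro _ v Hv)).
Qed.

Lemma moment_bound (k : nat) (f : R -> C) (a : nat -> C) :
  tame f a -> exists B, forall s, 0 < s -> Cmod (moment k f s) <= B / s ^ S k.
Proof.
  intros Ht. destruct (proj2 Ht O) as [B HB]. exists (B * INR (fact k)). intros s Hs.
  destruct (moment_exists k f B s (proj1 Ht) HB Hs) as [v [Hv Hle]].
  rewrite (improper_unique _ _ _ (moment_spec k f a s Ht Hs) Hv).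
  unfold Rdiv in *. rewrite Rmult_assoc. exact Hle.
Qed.

(** One step of Watson's lemma, from [f = a_0 + t (divdiff f a)]. *)
Lemma moment_S (k : nat) (f : R -> C) (a : nat -> C) (s : R) :
  tame f a -> 0 < s ->
  moment k f s = Cplus (Cmult (a O) (RtoC (INR (fact k) / s ^ S k))) (moment (S k) (divdiff f a) s).
Proof.
  intros Ht Hs. apply improper_unique with (1 := moment_spec k f a s Ht Hs).
  assert (H := improper_plus _ _ _ _ (improper_scal (a O) _ _ (improper_pow_exp s k Hs))
    (moment_spec (S k) _ _ s (tame_divdiff _ _ Ht) Hs)).
  apply improper_ext with (2 := H). intros t Hpos.
  unfold moment_integrand, divdiff. rewrite cexpm_RtoC. cbn [pow]. rewrite !RtoC_mult.
  field. apply RtoC_neq_0; lra.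
Qed.

(** Successive Taylor coefficients of [f] meet log integrals of decreasing order; the last divided
    difference remains under a plain Laplace transform. *)
Fixpoint reg_integral (n : nat) (f : R -> C) (a : nat -> C) (s : R) : C :=
  Cplus (Cmult (a O) (log_integral n (RtoC s)))
    match n with
    | O => moment 0 (divdiff f a) s
    | S n => reg_integral n (divdiff f a) (seq_tail a) s
    end.

Lemma improper_reg_quot_tame (n : nat) (f : R -> C) (a : nat -> C) (s : R) :
  tame f a -> 0 < s ->
  improper (fun t => reg_quot n (cauchy_prod a (exp_coef (RtoC s))) (RtoC t) (Cmult (f t) (cexpm (RtoC s) t)))
    (reg_integral n f a s).
Proof.
  intros Hf Hs. revert f a Hf; induction n as [|n IH]; intros f a Hf.
  - assert (H := improper_plus _ _ _ _ (improper_scal (a O) _ _ (improper_reg_quot_cexpm 0 (RtoC s) Hs))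
      (moment_spec 0 _ _ s (tame_divdiff _ _ Hf) Hs)).
    apply improper_ext with (2 := H). intros t _. rewrite reg_quot_cauchy_prod_O.
    unfold moment_integrand, divdiff. simpl pow. ring.
  - assert (H := improper_plus _ _ _ _ (improper_scal (a O) _ _ (improper_reg_quot_cexpm (S n) (RtoC s) Hs))
      (IH _ _ (tame_divdiff _ _ Hf))).
    apply improper_ext with (2 := H). intros t _. rewrite reg_quot_cauchy_prod_S. reflexivity.
Qed.

(** * Asymptotic expansions *)

Lemma csum_S (F : nat -> C) (m : nat) : sum_n F (S m) = Cplus (sum_n F m) (F (S m)) :> C.
Proof. exact (sum_Sn (G := C_AbelianMonoid) F m). Qed.

Lemma csum_O (F : nat -> C) : sum_n F O = F O :> C.
Proof. exact (sum_O (G := C_AbelianMonoid) F). Qed.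

Lemma csum_shift (F : nat -> C) (m : nat) :
  sum_n F (S m) = Cplus (F O) (sum_n (fun i => F (S i)) m) :> C.
Proof.
  induction m as [|m IH]; [rewrite csum_S !csum_O; reflexivity|].
  rewrite csum_S IH csum_S. ring.
Qed.

Lemma csum_ext (F G : nat -> C) (m : nat) :
  (forall i, (i <= m)%nat -> F i = G i) -> sum_n F m = sum_n G m :> C.
Proof. intros H; exact (sum_n_ext_loc (G := C_AbelianMonoid) F G m H). Qed.

Lemma csum_plus (F G : nat -> C) (m : nat) :
  sum_n (fun i => Cplus (F i) (G i)) m = Cplus (sum_n F m) (sum_n G m) :> C.
Proof. induction m as [|m IH]; [rewrite !csum_O | rewrite !csum_S IH]; ring. Qed.

Lemma csum_scal (c : C) (F : nat -> C) (m : nat) :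
  sum_n (fun i => Cmult c (F i)) m = Cmult c (sum_n F m) :> C.
Proof. induction m as [|m IH]; [rewrite !csum_O | rewrite !csum_S IH]; ring. Qed.

Lemma csum_zero (F : nat -> C) (m : nat) :
  (forall i, (i <= m)%nat -> F i = RtoC 0) -> sum_n F m = RtoC 0 :> C.
Proof.
  induction m as [|m IH]; intros H; [rewrite csum_O; apply H; lia|].
  rewrite csum_S IH; [rewrite H; [ring | lia]|]. intros; apply H; lia.
Qed.

Lemma csum_single (F : nat -> C) (k m : nat) :
  (k <= m)%nat -> (forall i, i <> k -> F i = RtoC 0) -> sum_n F m = F k :> C.
Proof.
  intros Hk H. induction m as [|m IH].
  - rewrite csum_O. f_equal; lia.
  - rewrite csum_S. destruct (Nat.eq_dec k (S m)) as [->|Hne].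
    + rewrite csum_zero; [ring|]. intros i Hi; apply H; lia.
    + rewrite IH; [|lia]. rewrite (H (S m)); [ring | lia].
Qed.

Lemma expansion_plus (M : nat) (a a' : nat -> C) (b b' : Z -> C) (N s : nat) :
  expansion M (fun m => Cplus (a m) (a' m)) (fun z => Cplus (b z) (b' z)) N s =
  Cplus (expansion M a b N s) (expansion M a' b' N s).
Proof.
  unfold expansion.
  rewrite (csum_ext (fun m => Cmult (Cplus (a m) (a' m)) _)
    (fun m => Cplus (Cmult (a m) (RtoC (INR s ^ m * ln (INR s)))) (Cmult (a' m) (RtoC (INR s ^ m * ln (INR s))))) M);
    [|intros; ring].
  rewrite csum_plus. cbv zeta.
  rewrite (csum_ext _ (fun i => Cplus (Cmult (b (Z.of_nat i - Z.of_nat N)%Z) (RtoC (powerRZ (INR s) (Z.of_nat i - Z.of_nat N))))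
     (Cmult (b' (Z.of_nat i - Z.of_nat N)%Z) (RtoC (powerRZ (INR s) (Z.of_nat i - Z.of_nat N))))) (M + N));
    [|intros; ring].
  rewrite csum_plus. ring.
Qed.

Lemma expansion_scal (c : C) (M : nat) (a : nat -> C) (b : Z -> C) (N s : nat) :
  expansion M (fun m => Cmult c (a m)) (fun z => Cmult c (b z)) N s =
  Cmult c (expansion M a b N s).
Proof.
  unfold expansion.
  rewrite (csum_ext (fun m => Cmult (Cmult c (a m)) _)
    (fun m => Cmult c (Cmult (a m) (RtoC (INR s ^ m * ln (INR s))))) M); [|intros; ring].
  rewrite csum_scal. cbv zeta.
  rewrite (csum_ext _ (fun i => Cmult c (Cmult (b (Z.of_nat i - Z.of_nat N)%Z) (RtoC (powerRZ (INR s) (Z.of_nat i - Z.of_nat N))))) (M + N));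
    [|intros; ring].
  rewrite csum_scal. ring.
Qed.

(** The index of the second sum starts at the exponent [-N], so the new term enters at the front and
    shifts all the others. *)
Lemma expansion_S (M : nat) (a : nat -> C) (b : Z -> C) (N s : nat) :
  expansion M a b (S N) s =
  Cplus (expansion M a b N s) (Cmult (b (- Z.of_nat (S N))%Z) (RtoC (powerRZ (INR s) (- Z.of_nat (S N))))).
Proof.
  unfold expansion. rewrite -plus_n_Sm csum_shift. cbv zeta.
  rewrite (csum_ext (fun i => Cmult (b (Z.of_nat (S i) - Z.of_nat (S N))%Z) _)
    (fun i => Cmult (b (Z.of_nat i - Z.of_nat N)%Z) (RtoC (powerRZ (INR s) (Z.of_nat i - Z.of_nat N)))) (M + N)).
  - replace (Z.of_nat 0 - Z.of_nat (S N))%Z with (- Z.of_nat (S N))%Z by lia. ring.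
  - intros i _. replace (Z.of_nat (S i) - Z.of_nat (S N))%Z with (Z.of_nat i - Z.of_nat N)%Z by lia.
    reflexivity.
Qed.

(** Here [M] is fixed, unlike in [is_constant_term], so that expansions can be added
    coefficientwise. *)
Definition has_constant_term (M : nat) (u : nat -> C) (c : C) : Prop :=
  exists a b, has_expansion u M a b /\ b 0%Z = c.

Lemma is_lim_seq_0_bound (u v : nat -> R) :
  (forall s, (1 <= s)%nat -> 0 <= u s <= v s) -> is_lim_seq v 0 -> is_lim_seq u 0.
Proof.
  intros H Hv. apply is_lim_seq_le_le_loc with (u := fun _ => 0) (w := v).
  - exists 1%nat. intros s Hs; apply H; lia.
  - apply is_lim_seq_const.
  - exact Hv.
Qed.

Lemma has_constant_term_ext (M : nat) (u v : nat -> C) (c : C) :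
  (forall s, (1 <= s)%nat -> u s = v s) -> has_constant_term M u c -> has_constant_term M v c.
Proof.
  intros H (a & b & Hab & Hc). exists a, b; split; [|exact Hc]. intros N.
  apply is_lim_seq_ext_loc with (2 := Hab N). exists 1%nat. intros s Hs. rewrite H //.
Qed.

Lemma pow_INR_pos (s N : nat) : 0 <= INR s ^ N.
Proof. apply pow_le, pos_INR. Qed.

Lemma has_constant_term_plus (M : nat) (u v : nat -> C) (c d : C) :
  has_constant_term M u c -> has_constant_term M v d ->
  has_constant_term M (fun s => Cplus (u s) (v s)) (Cplus c d).
Proof.
  intros (a & b & Hab & <-) (a' & b' & Hab' & <-).
  exists (fun m => Cplus (a m) (a' m)), (fun z => Cplus (b z) (b' z)). split; [|reflexivity].
  intros N. eapply is_lim_seq_0_bound; [|replace 0 with (0 + 0) by ring; apply (is_lim_seq_plus' _ _ _ _ (Hab N) (Hab' N))].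
  intros s _. cbv beta. assert (Hp := pow_INR_pos s N). split.
  - apply Rmult_le_pos; [apply Cmod_ge_0 | exact Hp].
  - rewrite -Rmult_plus_distr_r. apply Rmult_le_compat_r; [exact Hp|].
    rewrite expansion_plus.
    replace (Cminus _ _) with (Cplus (Cminus (u s) (expansion M a b N s)) (Cminus (v s) (expansion M a' b' N s))) by ring.
    apply Cmod_triangle.
Qed.

Lemma has_constant_term_scal (M : nat) (k : C) (u : nat -> C) (c : C) :
  has_constant_term M u c -> has_constant_term M (fun s => Cmult k (u s)) (Cmult k c).
Proof.
  intros (a & b & Hab & <-).
  exists (fun m => Cmult k (a m)), (fun z => Cmult k (b z)). split; [|reflexivity].
  intros N. eapply is_lim_seq_0_bound; [|replace (Finite 0) with (Rbar_mult (Cmod k) 0) by (simpl; f_equal; ring); apply (is_lim_seq_scal_l _ (Cmod k) _ (Hab N))].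
  intros s _. cbv beta. assert (Hp := pow_INR_pos s N). split.
  - apply Rmult_le_pos; [apply Cmod_ge_0 | exact Hp].
  - rewrite expansion_scal.
    replace (Cminus _ _) with (Cmult k (Cminus (u s) (expansion M a b N s))) by ring.
    rewrite Cmod_mult. right; ring.
Qed.

Lemma has_constant_term_exact (M : nat) (u : nat -> C) (a : nat -> C) (b : Z -> C) (c : C) :
  (forall N s, (1 <= s)%nat -> expansion M a b N s = u s) -> b 0%Z = c -> has_constant_term M u c.
Proof.
  intros H Hc. exists a, b; split; [|exact Hc]. intros N.
  apply is_lim_seq_0_bound with (v := fun _ => 0); [|apply is_lim_seq_const].
  intros s Hs. rewrite H //. replace (Cminus (u s) (u s)) with (RtoC 0) by ring.
  rewrite Cmod_0; lra.
Qed.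

Lemma has_constant_term_pow (M m : nat) :
  (m <= M)%nat -> has_constant_term M (fun s => RtoC (INR s ^ m)) (if Nat.eqb m 0 then RtoC 1 else RtoC 0).
Proof.
  intros Hm. apply has_constant_term_exact with (a := fun _ => RtoC 0)
    (b := fun z => if Z.eqb z (Z.of_nat m) then RtoC 1 else RtoC 0).
  - intros N s Hs. unfold expansion. rewrite csum_zero; [|intros; ring].
    rewrite (csum_single _ (m + N)%nat); [|lia|].
    + cbv zeta. replace (Z.of_nat (m + N) - Z.of_nat N)%Z with (Z.of_nat m) by lia.
      rewrite Z.eqb_refl -pow_powerRZ. ring.
    + intros i Hi. cbv zeta. destruct (Z.eqb_spec (Z.of_nat i - Z.of_nat N) (Z.of_nat m)); [lia | ring].
  - destruct m; reflexivity.
Qed.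

Lemma has_constant_term_pow_ln (M m : nat) :
  (m <= M)%nat -> has_constant_term M (fun s => RtoC (INR s ^ m * ln (INR s))) (RtoC 0).
Proof.
  intros Hm. apply has_constant_term_exact with
    (a := fun i => if Nat.eqb i m then RtoC 1 else RtoC 0) (b := fun _ => RtoC 0); [|reflexivity].
  intros N s Hs. unfold expansion. rewrite [X in Cplus _ X]csum_zero; [|intros; cbv zeta; ring].
  rewrite (csum_single _ m); [|lia|].
  - rewrite Nat.eqb_refl. ring.
  - intros i Hi. destruct (Nat.eqb_spec i m); [lia | ring].
Qed.

(** Watson's lemma: only negative powers of [s] occur. *)
Lemma has_constant_term_moment (M : nat) (f : R -> C) (a : nat -> C) :
  tame f a -> has_constant_term M (fun s => moment 0 f (INR s)) (RtoC 0).
Proof.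
  intros Hf.
  (* The coefficient of [s^(-p)] is [(p-1)! a_(p-1)], hence the predecessors. *)
  set (b := fun z => match z with
    | Zneg p => Cmult (a (pred (Pos.to_nat p))) (RtoC (INR (fact (pred (Pos.to_nat p)))))
    | _ => RtoC 0 end).
  exists (fun _ => RtoC 0), b. split; [|reflexivity]. intros N.
  (* After [N] steps the error is exactly a moment of order [N], hence [O(s^(-N-1))]: one power
     better than required. *)
  assert (H : exists g c, tame g c /\ (forall i, c i = a (i + N)%nat) /\ forall s, (1 <= s)%nat ->
     moment 0 f (INR s) = Cplus (expansion M (fun _ => RtoC 0) b N s) (moment N g (INR s))).
  { induction N as [|N (g & c & Hg & Hc & IH)].
    - exists f, a. split; [exact Hf|]. split; [intros i; f_equal; lia|].
      intros s Hs. unfold expansion. rewrite !csum_zero; [ring | |].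
      + intros i _. cbv zeta. replace (Z.of_nat i - Z.of_nat 0)%Z with (Z.of_nat i) by lia.
        destruct i; simpl; ring.
      + intros; ring.
    - exists (divdiff g c), (seq_tail c). split; [apply tame_divdiff, Hg|].
      split; [intros i; unfold seq_tail; rewrite Hc; f_equal; lia|].
      intros s Hs. assert (Hs' : 0 < INR s) by (apply lt_0_INR; lia).
      rewrite IH // (moment_S N g c) // expansion_S Hc.
      replace (b (- Z.of_nat (S N))%Z) with (Cmult (a (0 + N)%nat) (RtoC (INR (fact N)))).
      2: { unfold b. simpl. rewrite SuccNat2Pos.id_succ. reflexivity. }
      rewrite powerRZ_neg' -pow_powerRZ /Rdiv (RtoC_mult (INR (fact N)) (/ INR s ^ S N)). ring. }
  destruct H as (g & c & Hg & _ & H).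
  destruct (moment_bound N g c Hg) as [B HB].
  apply is_lim_seq_0_bound with (v := fun s => B * / INR s).
  - intros s Hs. assert (Hs' : 0 < INR s) by (apply lt_0_INR; lia). split.
    + apply Rmult_le_pos; [apply Cmod_ge_0 | apply pow_INR_pos].
    + rewrite H //. replace (Cminus _ _) with (moment N g (INR s)) by ring.
      apply Rle_trans with (B / INR s ^ S N * INR s ^ N).
      * apply Rmult_le_compat_r; [apply pow_INR_pos | apply HB, Hs'].
      * right. simpl. field. split; [lra | apply pow_nonzero; lra].
  - replace (Finite 0) with (Rbar_mult B 0) by (simpl; f_equal; ring).
    apply is_lim_seq_scal_l. apply (is_lim_seq_inv _ p_infty); [apply is_lim_seq_INR | discriminate].
Qed.

Lemma exp_coef_RtoC (x : R) (n : nat) : exp_coef (RtoC x) n = Cmult (exp_coef (RtoC 1) n) (RtoC (x ^ n)).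
Proof.
  unfold exp_coef. replace (Copp (RtoC x)) with (Cmult (Copp (RtoC 1)) (RtoC x)) by ring.
  rewrite Cpow_mult_l RtoC_pow. unfold Cdiv; ring.
Qed.

(** The power [s^n] contributes a constant only for [n = 0], where its factor, the harmonic number,
    is 0. *)
Lemma has_constant_term_log_integral (M n : nat) :
  (n <= M)%nat -> has_constant_term M (fun s => log_integral n (RtoC (INR s))) (RtoC 0).
Proof.
  intros Hn.
  assert (H := has_constant_term_scal _ (exp_coef (RtoC 1) n) _ _ (has_constant_term_plus _ _ _ _ _
    (has_constant_term_scal _ (RtoC (harmonic n)) _ _ (has_constant_term_pow M n Hn))
    (has_constant_term_scal _ (Copp (RtoC 1)) _ _ (has_constant_term_pow_ln M n Hn)))).
  replace (RtoC 0) with (Cmult (exp_coef (RtoC 1) n) (Cplus (Cmult (RtoC (harmonic n))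
    (if Nat.eqb n 0 then RtoC 1 else RtoC 0)) (Cmult (Copp (RtoC 1)) (RtoC 0)))).
  - apply has_constant_term_ext with (2 := H). intros s Hs. unfold log_integral.
    rewrite Clog_RtoC; [|apply lt_0_INR; lia]. rewrite (exp_coef_RtoC (INR s)) (RtoC_mult (INR s ^ n)). ring.
  - destruct n; simpl; ring.
Qed.

Lemma has_constant_term_reg_integral (M n : nat) (f : R -> C) (a : nat -> C) :
  (n <= M)%nat -> tame f a -> has_constant_term M (fun s => reg_integral n f a (INR s)) (RtoC 0).
Proof.
  intros Hn. revert f a; induction n as [|n IH]; intros f a Hf.
  - replace (RtoC 0) with (Cplus (Cmult (a O) (RtoC 0)) (RtoC 0)) by ring.
    apply has_constant_term_plus.
    + apply has_constant_term_scal, has_constant_term_log_integral, Hn.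
    + apply has_constant_term_moment with (a := seq_tail a), tame_divdiff, Hf.
  - replace (RtoC 0) with (Cplus (Cmult (a O) (RtoC 0)) (RtoC 0)) by ring.
    apply (has_constant_term_plus M (fun s => Cmult (a O) (log_integral (S n) (RtoC (INR s))))).
    + apply has_constant_term_scal, has_constant_term_log_integral, Hn.
    + apply IH; [lia | apply tame_divdiff, Hf].
Qed.

(** The product coefficient is the polynomial in [s] with terms [a_i (-s)^(n-i) / (n-i)!]; its
    constant term is the one with [i = n]. *)
Lemma has_constant_term_cauchy_prod (M n : nat) (a : nat -> C) :
  (n <= M)%nat -> has_constant_term M (fun s => cauchy_prod a (exp_coef (RtoC (INR s))) n) (a n).
Proof.
  intros Hn.
  assert (Hpw : forall m, (m <= M)%nat -> has_constant_term M (fun s => exp_coef (RtoC (INR s)) m) (if Nat.eqb m 0 then RtoC 1 else RtoC 0)).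
  { intros m Hm. replace (if Nat.eqb m 0 then RtoC 1 else RtoC 0) with
      (Cmult (exp_coef (RtoC 1) m) (if Nat.eqb m 0 then RtoC 1 else RtoC 0)).
    - apply has_constant_term_ext with (2 := has_constant_term_scal _ (exp_coef (RtoC 1) m) _ _ (has_constant_term_pow M m Hm)).
      intros s _. rewrite (exp_coef_RtoC (INR s)). reflexivity.
    - destruct m; simpl; [rewrite exp_coef_O|]; ring. }
  revert a; induction n as [|n IH]; intros a.
  - replace (a O) with (Cmult (a O) (RtoC 1)) by ring.
    apply (has_constant_term_scal M (a O) (fun s => exp_coef (RtoC (INR s)) 0)), (Hpw O Hn).
  - replace (a (S n)) with (Cplus (Cmult (a O) (RtoC 0)) (seq_tail a n)) by (unfold seq_tail; ring).
    apply (has_constant_term_plus M (fun s => Cmult (a O) (exp_coef (RtoC (INR s)) (S n)))).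
    + apply has_constant_term_scal, (Hpw (S n) Hn).
    + apply IH; lia.
Qed.

(** * Uniqueness of the constant term *)

Definition powlog_sum (A B : nat -> C) (M s : nat) : C :=
  sum_n (fun m => Cmult (Cplus (Cmult (A m) (RtoC (ln (INR s)))) (B m)) (RtoC (INR s ^ m))) M.

Lemma powlog_sum_S (A B : nat -> C) (M s : nat) :
  powlog_sum A B (S M) s =
  Cplus (powlog_sum A B M s)
    (Cmult (Cplus (Cmult (A (S M)) (RtoC (ln (INR s)))) (B (S M))) (RtoC (INR s ^ S M))).
Proof. unfold powlog_sum. apply csum_S. Qed.

Lemma is_lim_seq_ln_INR : is_lim_seq (fun s => ln (INR s)) p_infty.
Proof.
  apply (is_lim_comp_seq ln INR p_infty p_infty); [apply is_lim_ln_p | | apply is_lim_seq_INR].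
  exists 0%nat. intros; discriminate.
Qed.

Lemma is_lim_seq_inv_INR : is_lim_seq (fun s => / INR s) 0.
Proof. apply (is_lim_seq_inv _ p_infty); [apply is_lim_seq_INR | discriminate]. Qed.

Lemma is_lim_seq_ln_div_INR : is_lim_seq (fun s => ln (INR s) / INR s) 0.
Proof.
  apply (is_lim_comp_seq (fun x => ln x / x) INR p_infty 0);
    [apply is_lim_div_ln_p | | apply is_lim_seq_INR].
  exists 0%nat. intros; discriminate.
Qed.

Lemma ln_INR_nonneg (s : nat) : (1 <= s)%nat -> 0 <= ln (INR s).
Proof.
  intros Hs. apply le_INR in Hs. simpl in Hs. rewrite -ln_1.
  destruct Hs as [Hs| <-]; [apply Rlt_le, ln_increasing; lra | lra].
Qed.

(** As [log s = o(s)], all terms up to degree [M] are negligible against [s^(M+1)], which isolates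
    the leading coefficients. *)
Lemma powlog_sum_small (A B : nat -> C) (M : nat) :
  is_lim_seq (fun s => Cmod (powlog_sum A B M s) / INR s ^ S M) 0.
Proof.
  assert (Hab : forall a b : C, is_lim_seq (fun s => Cmod a * (ln (INR s) / INR s) + Cmod b * / INR s) 0).
  { intros a b. replace (Finite 0) with (Finite (Cmod a * 0 + Cmod b * 0)) by (f_equal; ring).
    apply is_lim_seq_plus'; apply (is_lim_seq_scal_l _ _ (Finite 0));
      [apply is_lim_seq_ln_div_INR | apply is_lim_seq_inv_INR]. }
  assert (Hb : forall a b s m, (1 <= s)%nat ->
    Cmod (Cmult (Cplus (Cmult a (RtoC (ln (INR s)))) b) (RtoC (INR s ^ m))) / INR s ^ S m <=
    Cmod a * (ln (INR s) / INR s) + Cmod b * / INR s).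
  { intros a b s m Hs. assert (Hs' : 0 < INR s) by (apply lt_0_INR; lia).
    assert (Hp : 0 < INR s ^ m) by (apply pow_lt, Hs').
    rewrite Cmod_mult Cmod_R Rabs_pos_eq; [|lra].
    apply Rle_trans with ((Cmod a * ln (INR s) + Cmod b) * / INR s).
    - replace (_ / _) with (Cmod (Cplus (Cmult a (RtoC (ln (INR s)))) b) * / INR s)
        by (simpl; field; lra).
      apply Rmult_le_compat_r; [apply Rlt_le, Rinv_0_lt_compat, Hs'|].
      eapply Rle_trans; [apply Cmod_triangle|].
      rewrite Cmod_mult Cmod_R Rabs_pos_eq; [lra | apply ln_INR_nonneg, Hs].
    - right. unfold Rdiv; ring. }
  induction M as [|M IH].
  - apply is_lim_seq_0_bound with (2 := Hab (A O) (B O)). intros s Hs.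
    assert (Hs' : 0 < INR s) by (apply lt_0_INR; lia). split.
    + apply Rmult_le_pos; [apply Cmod_ge_0 | apply Rlt_le, Rinv_0_lt_compat, pow_lt, Hs'].
    + unfold powlog_sum. rewrite csum_O. apply Hb, Hs.
  - assert (H := is_lim_seq_plus' _ _ _ _ IH (Hab (A (S M)) (B (S M)))).
    rewrite Rplus_0_r in H.
    apply is_lim_seq_0_bound with (2 := H). intros s Hs.
    assert (Hs' : 0 < INR s) by (apply lt_0_INR; lia).
    assert (Hs1 : 1 <= INR s) by (apply le_INR in Hs; exact Hs). split.
    + apply Rmult_le_pos; [apply Cmod_ge_0 | apply Rlt_le, Rinv_0_lt_compat, pow_lt, Hs'].
    + rewrite powlog_sum_S.
      apply Rle_trans with (Cmod (powlog_sum A B M s) / INR s ^ S (S M) +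
        Cmod (Cmult (Cplus (Cmult (A (S M)) (RtoC (ln (INR s)))) (B (S M))) (RtoC (INR s ^ S M))) / INR s ^ S (S M)).
      * rewrite -Rdiv_plus_distr. apply Rmult_le_compat_r; [apply Rlt_le, Rinv_0_lt_compat, pow_lt, Hs'|].
        apply Cmod_triangle.
      * apply Rplus_le_compat; [|apply Hb, Hs].
        apply Rmult_le_compat_l; [apply Cmod_ge_0|].
        apply Rinv_le_contravar; [apply pow_lt, Hs'|].
        change (INR s ^ S (S M)) with (INR s * INR s ^ S M).
        generalize (pow_lt (INR s) (S M) Hs'); nra.
Qed.

(** A nonzero [a] would make [Cmod a * log s] bounded in the limit by [Cmod b], although it tends to
    infinity. *)
Lemma affine_log_zero (a b : C) :
  is_lim_seq (fun s => Cmod (Cplus (Cmult a (RtoC (ln (INR s)))) b)) 0 -> a = RtoC 0 /\ b = RtoC 0.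
Proof.
  intros H.
  assert (Ha : a = RtoC 0).
  { apply Cmod_eq_0. destruct (Rle_lt_or_eq_dec 0 (Cmod a) (Cmod_ge_0 a)) as [Ha|Ha]; [exfalso|auto].
    assert (Hle : Rbar_le p_infty (0 + Cmod b)).
    { apply is_lim_seq_le_loc with (u := fun s => Cmod a * ln (INR s))
        (v := fun s => Cmod (Cplus (Cmult a (RtoC (ln (INR s)))) b) + Cmod b).
      - exists 1%nat. intros s Hs.
        replace (Cmod a * ln (INR s)) with (Cmod (Cmult a (RtoC (ln (INR s))))).
        + replace (Cmult a (RtoC (ln (INR s)))) with
            (Cplus (Cplus (Cmult a (RtoC (ln (INR s)))) b) (Copp b)) at 1 by ring.
          eapply Rle_trans; [apply Cmod_triangle|]. rewrite Cmod_opp; lra.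
        + rewrite Cmod_mult Cmod_R Rabs_pos_eq; [reflexivity | apply ln_INR_nonneg, Hs].
      - replace p_infty with (Rbar_mult (Cmod a) p_infty).
        + apply is_lim_seq_scal_l, is_lim_seq_ln_INR.
        + apply is_Rbar_mult_unique. apply is_Rbar_mult_sym, is_Rbar_mult_p_infty_pos. exact Ha.
      - apply is_lim_seq_plus'; [exact H | apply is_lim_seq_const]. }
    exact Hle. }
  split; [exact Ha|]. subst a. apply Cmod_eq_0.
  assert (H' : is_lim_seq (fun _ : nat => Cmod b) 0).
  { apply is_lim_seq_ext with (2 := H). intros s. f_equal; ring. }
  assert (E := is_lim_seq_unique _ _ H'). rewrite Lim_seq_const in E. injection E; auto.
Qed.

(** Division by the highest power leaves an affine function of [log s] that tends to 0; once its two
    coefficients vanish, the degree drops. *)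
Lemma powlog_sum_zero (A B : nat -> C) (M : nat) :
  is_lim_seq (fun s => Cmod (powlog_sum A B M s)) 0 ->
  forall m, (m <= M)%nat -> A m = RtoC 0 /\ B m = RtoC 0.
Proof.
  induction M as [|M IH]; intros H m Hm.
  - replace m with O by lia. apply affine_log_zero.
    apply is_lim_seq_ext with (2 := H). intros s. unfold powlog_sum. rewrite csum_O. f_equal.
    simpl pow. ring.
  - assert (Htop : A (S M) = RtoC 0 /\ B (S M) = RtoC 0).
    { apply affine_log_zero.
      assert (HP := is_lim_seq_plus' _ _ _ _ H (powlog_sum_small A B M)). rewrite Rplus_0_r in HP.
      apply is_lim_seq_0_bound with (2 := HP). intros s Hs.
      assert (Hs1 : 1 <= INR s) by (apply le_INR in Hs; exact Hs).
      split; [apply Cmod_ge_0|].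
      assert (Hp1 : 1 <= INR s ^ S M) by (apply pow_R1_Rle, Hs1).
      set (q := Cplus _ _).
      assert (E : Cmult q (RtoC (INR s ^ S M)) = Cminus (powlog_sum A B (S M) s) (powlog_sum A B M s))
        by (rewrite powlog_sum_S; fold q; ring).
      apply (f_equal Cmod) in E. rewrite Cmod_mult Cmod_R Rabs_pos_eq in E; [|lra].
      replace (Cmod q) with (Cmod q * INR s ^ S M / INR s ^ S M) by (field; lra).
      rewrite E. apply Rle_trans with
        ((Cmod (powlog_sum A B (S M) s) + Cmod (powlog_sum A B M s)) / INR s ^ S M).
      - apply Rmult_le_compat_r; [apply Rlt_le, Rinv_0_lt_compat; lra|].
        eapply Rle_trans; [apply Cmod_triangle|]. rewrite Cmod_opp; lra.
      - rewrite Rdiv_plus_distr. apply Rplus_le_compat_r.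
        rewrite -[X in _ <= X]Rdiv_1_r. apply Rmult_le_compat_l; [apply Cmod_ge_0|].
        apply Rinv_le_contravar; lra. }
    destruct (Nat.eq_dec m (S M)) as [->|Hne]; [exact Htop|].
    apply IH; [|lia]. apply is_lim_seq_ext with (2 := H). intros s. f_equal.
    rewrite powlog_sum_S. destruct Htop as [-> ->]. ring.
Qed.

(** Padding with zeros brings two expansions with bounds [M] and [M'] to the common bound
    [M + M']. *)
Definition seq_trunc (M : nat) (a : nat -> C) (m : nat) : C := if Nat.leb m M then a m else RtoC 0.

Lemma powlog_sum_trunc (A B : nat -> C) (M d s : nat) :
  powlog_sum A B M s = powlog_sum (seq_trunc M A) (seq_trunc M B) (M + d) s.
Proof.
  induction d as [|d IH].
  - rewrite Nat.add_0_r. apply csum_ext. intros i Hi. unfold seq_trunc.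
    rewrite (proj2 (Nat.leb_le i M) Hi). reflexivity.
  - rewrite -plus_n_Sm powlog_sum_S -IH. unfold seq_trunc.
    rewrite (proj2 (Nat.leb_gt (S (M + d)) M)); [ring | lia].
Qed.

Lemma powlog_sum_minus (A B A' B' : nat -> C) (M s : nat) :
  Cminus (powlog_sum A B M s) (powlog_sum A' B' M s) =
  powlog_sum (fun m => Cminus (A m) (A' m)) (fun m => Cminus (B m) (B' m)) M s.
Proof.
  induction M as [|M IH].
  - unfold powlog_sum; rewrite !csum_O. ring.
  - rewrite !powlog_sum_S -IH. ring.
Qed.

Lemma expansion_O (M : nat) (a : nat -> C) (b : Z -> C) (s : nat) :
  expansion M a b 0 s = powlog_sum a (fun m => b (Z.of_nat m)) M s.
Proof.
  unfold expansion, powlog_sum. rewrite Nat.add_0_r -csum_plus. apply csum_ext.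
  intros i _. cbv zeta. replace (Z.of_nat i - Z.of_nat 0)%Z with (Z.of_nat i) by lia.
  rewrite -pow_powerRZ RtoC_mult. ring.
Qed.

(** Truncation at order 0 keeps the constant term with an error tending to 0, so the difference of
    two such truncations is a power-log sum tending to 0. *)
Lemma is_constant_term_unique (u : nat -> C) (c c' : C) :
  is_constant_term u c -> is_constant_term u c' -> c = c'.
Proof.
  intros (M & a & b & H & ->) (M' & a' & b' & H' & ->).
  assert (HL := is_lim_seq_plus' _ _ _ _ (H O) (H' O)). rewrite Rplus_0_r in HL.
  set (B := fun m : nat => b (Z.of_nat m)). set (B' := fun m : nat => b' (Z.of_nat m)).
  assert (Hlim : is_lim_seq (fun s => Cmod (powlog_sum
     (fun m => Cminus (seq_trunc M a m) (seq_trunc M' a' m))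
     (fun m => Cminus (seq_trunc M B m) (seq_trunc M' B' m)) (M + M') s)) 0).
  { apply is_lim_seq_0_bound with (2 := HL). intros s _. split; [apply Cmod_ge_0|].
    rewrite -powlog_sum_minus -powlog_sum_trunc Nat.add_comm -powlog_sum_trunc.
    rewrite -(expansion_O M a b) -(expansion_O M' a' b') !Rmult_1_r.
    replace (Cminus _ _) with
      (Cplus (Copp (Cminus (u s) (expansion M a b 0 s))) (Cminus (u s) (expansion M' a' b' 0 s))) by ring.
    eapply Rle_trans; [apply Cmod_triangle|]. rewrite Cmod_opp. apply Rle_refl. }
  destruct (powlog_sum_zero _ _ _ Hlim O (Nat.le_0_l _)) as [_ H0].
  apply Ceq_minus. exact H0.
Qed.

(** * The field of integrands *)

Lemma generated_ext (G : (C -> C) -> Prop) (f g : C -> C) :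
  (forall z, f z = g z) -> generated_field G f -> generated_field G g.
Proof.
  intros H Hf. apply generated_eq with (1 := Hf). intros z.
  apply filter_forall; exact H.
Qed.

Lemma generated_minus (G : (C -> C) -> Prop) (f g : C -> C) :
  generated_field G f -> generated_field G g -> generated_field G (fun z => Cminus (f z) (g z)).
Proof. intros Hf Hg. apply (generated_add _ _ _ Hf (generated_opp _ _ Hg)). Qed.

(** Agreement with 0 on a punctured neighbourhood of 1 would include the positive real point
    [1 + eps / 2]. Positivity on the real axis is an easy test for all denominators below. *)
Lemma not_mero_eq_0 (f : C -> C) :
  (forall t, 0 < t -> f (RtoC t) <> RtoC 0) -> ~ mero_eq f (fun _ => RtoC 0).
Proof.
  intros H H0. destruct (H0 (RtoC 1)) as [eps Heps].
  assert (He := cond_pos eps).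
  apply (H (1 + eps / 2)); [lra|]. apply Heps.
  - split.
    + change (Rabs (1 + eps / 2 + - (1)) < eps). rewrite Rabs_pos_eq; lra.
    + change (Rabs (0 + - 0) < eps). rewrite Rabs_pos_eq; lra.
  - intros E. apply RtoC_inj in E. lra.
Qed.

Lemma generated_div (G : (C -> C) -> Prop) (f g : C -> C) :
  (forall t, 0 < t -> g (RtoC t) <> RtoC 0) ->
  generated_field G f -> generated_field G g -> generated_field G (fun z => Cdiv (f z) (g z)).
Proof.
  intros H Hf Hg. apply (generated_mul _ _ _ Hf (generated_inv _ _ Hg (not_mero_eq_0 _ H))).
Qed.

Definition constant_in_field (G : (C -> C) -> Prop) (c : C) : Prop := generated_field G (fun _ => c).

Lemma constant_INR (G : (C -> C) -> Prop) (n : nat) : constant_in_field G (RtoC (INR n)).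
Proof.
  apply generated_ext with (2 := generated_rat G (inject_Z (Z.of_nat n))). intros _.
  unfold Q2R; simpl. rewrite INR_IZR_INZ. f_equal; field.
Qed.

Lemma constant_minus (G : (C -> C) -> Prop) (c d : C) :
  constant_in_field G c -> constant_in_field G d -> constant_in_field G (Cminus c d).
Proof. apply generated_minus. Qed.

Lemma constant_pow (G : (C -> C) -> Prop) (c : C) (n : nat) :
  constant_in_field G c -> constant_in_field G (Cpow c n).
Proof.
  intros Hc. induction n as [|n IH]; [exact (constant_INR G 1)|].
  exact (generated_mul _ _ _ Hc IH).
Qed.

Lemma constant_exp_coef (G : (C -> C) -> Prop) (c : C) (n : nat) :
  constant_in_field G c -> constant_in_field G (exp_coef c n).
Proof.
  intros Hc. apply (generated_div G (fun _ => Cpow (Copp c) n)).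
  - intros; apply fact_neq.
  - apply constant_pow, generated_opp, Hc.
  - apply constant_INR.
Qed.

Lemma constant_cauchy_prod (G : (C -> C) -> Prop) (a b : nat -> C) (k : nat) :
  (forall i, constant_in_field G (a i)) -> (forall i, constant_in_field G (b i)) ->
  constant_in_field G (cauchy_prod a b k).
Proof.
  intros Ha Hb. revert a Ha; induction k as [|k IH]; intros a Ha.
  - exact (generated_mul _ _ _ (Ha O) (Hb O)).
  - apply (generated_add _ (fun _ => Cmult (a O) (b (S k))) (fun _ => cauchy_prod (seq_tail a) b k)).
    + exact (generated_mul _ _ _ (Ha O) (Hb (S k))).
    + apply IH. intros i; apply Ha.
Qed.

Lemma constant_cauchy_quot (G : (C -> C) -> Prop) (a b : nat -> C) (k : nat) :
  (forall i, constant_in_field G (a i)) -> (forall i, constant_in_field G (b i)) ->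
  constant_in_field G (cauchy_quot a b k).
Proof.
  intros Ha Hb. revert a Ha; induction k as [|k IH]; intros a Ha; [apply Ha|].
  apply IH. intros i. apply constant_minus; [apply Ha | exact (generated_mul _ _ _ (Ha O) (Hb (S i)))].
Qed.

Lemma generated_jet_rem (G : (C -> C) -> Prop) (a : nat -> C) (f : C -> C) (k : nat) :
  generated_field G (fun z => z) -> (forall i, constant_in_field G (a i)) -> generated_field G f ->
  generated_field G (fun z => jet_rem a k z (f z)).
Proof.
  intros Hz Ha. revert a f Ha; induction k as [|k IH]; intros a f Ha Hf; [exact Hf|].
  apply (IH (seq_tail a) (fun z => Cdiv (Cminus (f z) (a O)) z)); [intros i; apply Ha|].
  apply generated_div; [intros t Ht; apply RtoC_neq_0; lra | | exact Hz].
  exact (generated_minus G _ _ Hf (Ha O)).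
Qed.

Lemma generated_reg_quot (G : (C -> C) -> Prop) (n : nat) (a : nat -> C) (f : C -> C) :
  generated_field G (fun z => z) -> generated_field G (fun z => Cexp (Copp z)) ->
  (forall i, constant_in_field G (a i)) -> generated_field G f ->
  generated_field G (fun z => reg_quot n a z (f z)).
Proof.
  intros Hz He Ha Hf. apply generated_div; [intros t Ht; apply RtoC_neq_0; lra | | exact Hz].
  apply generated_minus; [apply generated_jet_rem; assumption|].
  exact (generated_mul _ _ _ (Ha n) He).
Qed.


(** * The generating function of the Bernoulli polynomials *)

(** The coefficients of [(1 - e^(-t))/t]: the constant 1 cancels, and dividing by [t] shifts the
    index. *)
Definition todd_denom_coef (i : nat) : C := Copp (exp_coef (RtoC 1) (S i)).

(* The [k]-th coefficient is [(-1)^k B_k(w) / k!]. *)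
Definition bernoulli_coef (w : C) : nat -> C := cauchy_quot (exp_coef w) todd_denom_coef.

Definition todd_denom (t : R) : C := Cdiv (Cminus (RtoC 1) (cexpm (RtoC 1) t)) (RtoC t).

Definition bernoulli_gen (w : C) (t : R) : C := Cdiv (cexpm w t) (todd_denom t).

Lemma one_minus_exp_pos (t : R) : 0 < t -> 0 < 1 - exp (- t).
Proof. intros Ht. rewrite -exp_0. generalize (exp_increasing (- t) 0); lra. Qed.

Lemma todd_denom_RtoC (t : R) : 0 < t -> todd_denom t = RtoC ((1 - exp (- t)) / t).
Proof.
  intros Ht. unfold todd_denom. rewrite cexpm_RtoC Rmult_1_l RtoC_div; [|lra].
  rewrite RtoC_minus. reflexivity.
Qed.

Lemma todd_denom_neq_0 (t : R) : 0 < t -> todd_denom t <> RtoC 0.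
Proof.
  intros Ht. rewrite todd_denom_RtoC //. apply RtoC_neq_0.
  apply Rgt_not_eq, Rdiv_lt_0_compat; [apply one_minus_exp_pos|]; exact Ht.
Qed.

(** Equivalent to [(1 + t) e^(-t) <= 1]. *)
Lemma todd_denom_inv_bound (t : R) : 0 < t -> Cmod (Cinv (todd_denom t)) <= 1 + t.
Proof.
  intros Ht. rewrite Cmod_inv; [|apply todd_denom_neq_0, Ht].
  assert (Hp := one_minus_exp_pos t Ht).
  rewrite todd_denom_RtoC // Cmod_R Rabs_pos_eq; [|apply Rlt_le, Rdiv_lt_0_compat; assumption].
  replace (/ ((1 - exp (- t)) / t)) with (t / (1 - exp (- t))) by (field; lra).
  apply Rle_div_l; [exact Hp|].
  assert (He : (1 + t) * exp (- t) <= 1).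
  { rewrite exp_Ropp. apply (Rmult_le_reg_r (exp t)); [apply exp_pos|].
    rewrite Rmult_assoc Rinv_l; [|apply Rgt_not_eq, exp_pos].
    generalize (exp_ineq1_le t); lra. }
  lra.
Qed.

Lemma jet_todd_denom : jet todd_denom todd_denom_coef.
Proof.
  assert (H := jet_scal (Copp (RtoC 1)) _ _ (jet_tail _ _ (jet_cexpm (RtoC 1) Rle_0_1))).
  apply jet_ext with (3 := H).
  - intros t Ht. unfold todd_denom. rewrite exp_coef_O. field. apply RtoC_neq_0; lra.
  - intros i. unfold todd_denom_coef, seq_tail. ring.
Qed.

Lemma jet_bernoulli_gen (w : C) : 0 < Re w -> jet (bernoulli_gen w) (bernoulli_coef w).
Proof.
  intros Hw. apply jet_cauchy_quot with (M := 2).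
  - intros t Ht. split; [apply todd_denom_neq_0; lra|].
    eapply Rle_trans; [apply todd_denom_inv_bound|]; lra.
  - unfold todd_denom_coef. rewrite exp_coef_S exp_coef_O. simpl INR. field.
  - apply jet_cexpm; lra.
  - apply jet_todd_denom.
Qed.

(** The linear growth of [t/(1 - e^(-t))] is absorbed by [e^(-wt)]: with [a = Re w], both
    [e^(-at) <= 1] and [t e^(-at) <= 1/a] hold. *)
Lemma tame_bernoulli_gen (w : C) : 0 < Re w -> tame (bernoulli_gen w) (bernoulli_coef w).
Proof.
  intros Hw. apply tame_intro with (B := 1 + / Re w); [| |apply jet_bernoulli_gen, Hw].
  - intros t Ht. apply Ccont_div; [apply Ccont_cexpm | | apply todd_denom_neq_0, Ht].
    apply Ccont_div; [apply Ccont_minus; [apply Ccont_const | apply Ccont_cexpm] | apply Ccont_id_RtoC |].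
    apply RtoC_neq_0; lra.
  - intros t Ht. unfold bernoulli_gen, Cdiv. rewrite Cmod_mult Cmod_cexpm.
    assert (He := exp_pos (- (Re w * t))).
    assert (He1 := exp_neg_le_1 (Re w * t) ltac:(nra)).
    assert (He2 : t * exp (- (Re w * t)) <= / Re w).
    { rewrite exp_Ropp. apply (Rmult_le_reg_r (Re w * exp (Re w * t))).
      - apply Rmult_lt_0_compat; [exact Hw | apply exp_pos].
      - replace (t * / exp (Re w * t) * (Re w * exp (Re w * t))) with (Re w * t)
          by (field; apply Rgt_not_eq, exp_pos).
        replace (/ Re w * (Re w * exp (Re w * t))) with (exp (Re w * t)) by (field; lra).
        generalize (exp_ineq1_le (Re w * t)); lra. }
    apply Rle_trans with (exp (- (Re w * t)) * (1 + t)); [|lra].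
    apply Rmult_le_compat_l; [lra | apply todd_denom_inv_bound, Ht].
Qed.

Lemma cexpm_plus (z z' : C) (t : R) : cexpm (Cplus z z') t = Cmult (cexpm z t) (cexpm z' t).
Proof. unfold cexpm. rewrite -Cexp_plus. f_equal; ring. Qed.

Lemma cexpm_0 (t : R) : cexpm (RtoC 0) t = RtoC 1.
Proof. rewrite cexpm_RtoC Rmult_0_l Ropp_0 exp_0. reflexivity. Qed.

(** The factor [1 - e^(-t)] clears the denominator. This is the difference equation of the Bernoulli
    polynomials in terms of their generating function. *)
Lemma bernoulli_gen_step (w : C) (s t : R) :
  0 < t ->
  Cminus (Cmult (bernoulli_gen w t) (cexpm (RtoC s) t)) (Cmult (bernoulli_gen w t) (cexpm (RtoC (s + 1)) t)) =
  Cmult (RtoC t) (cexpm (Cplus (RtoC s) w) t).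
Proof.
  intros Ht. assert (Ht0 : RtoC t <> RtoC 0) by (apply RtoC_neq_0; lra).
  rewrite RtoC_plus !cexpm_plus. unfold bernoulli_gen, todd_denom. field. split; [exact Ht0|].
  intros E. apply (todd_denom_neq_0 t Ht). unfold todd_denom. rewrite E. field. exact Ht0.
Qed.

(** Both sides are the asymptotic coefficients of [t e^(-(s+w)t)], so they agree by [jet_unique]. *)
Lemma bernoulli_coef_step (w : C) (s : R) :
  0 < Re w -> 0 <= s -> forall i,
  Cminus (cauchy_prod (bernoulli_coef w) (exp_coef (RtoC s)) i)
    (cauchy_prod (bernoulli_coef w) (exp_coef (RtoC (s + 1))) i) =
  seq_cons (RtoC 0) (exp_coef (Cplus (RtoC s) w)) i.
Proof.
  intros Hw Hs. assert (Hj := jet_bernoulli_gen w Hw).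
  refine (jet_unique _ _ _ (jet_minus _ _ _ _
    (jet_mult _ _ _ _ Hj (jet_cexpm (RtoC s) Hs))
    (jet_mult _ _ _ _ Hj (jet_cexpm (RtoC (s + 1)) _))) _); [simpl; lra|].
  apply jet_ext with (f := fun t => Cmult (RtoC t) (cexpm (Cplus (RtoC s) w) t))
    (a := seq_cons (RtoC 0) (exp_coef (Cplus (RtoC s) w))).
  - intros t Ht. rewrite bernoulli_gen_step //; lra.
  - reflexivity.
  - apply jet_cons_0, jet_cexpm. unfold Re in *; simpl; lra.
Qed.

(** * Telescoping and the constant term of the partial sums *)

Definition period_integrand (n : nat) (w : C) (s t : R) : C :=
  reg_quot (S n) (cauchy_prod (bernoulli_coef w) (exp_coef (RtoC s))) (RtoC t)
    (Cmult (bernoulli_gen w t) (cexpm (RtoC s) t)).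

(** The factor [t] in [bernoulli_gen_step] accounts for the order [S n] on the left against [n] on
    the right. *)
Lemma period_integrand_step (n : nat) (w : C) (s t : R) :
  0 < Re w -> 0 <= s -> 0 < t ->
  Cminus (period_integrand n w s t) (period_integrand n w (s + 1) t) =
  reg_quot n (exp_coef (Cplus (RtoC s) w)) (RtoC t) (cexpm (Cplus (RtoC s) w) t).
Proof.
  intros Hw Hs Ht. assert (Ht0 : RtoC t <> RtoC 0) by (apply RtoC_neq_0; lra).
  assert (Hc := bernoulli_coef_step w s Hw Hs).
  unfold period_integrand, reg_quot.
  rewrite -(jet_rem_cons_0 (exp_coef (Cplus (RtoC s) w)) n (RtoC t)) // -bernoulli_gen_step //.
  rewrite -(jet_rem_ext _ _ _ _ _ (fun i _ => Hc i)) jet_rem_minus.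
  rewrite -[exp_coef (Cplus (RtoC s) w) n]/(seq_cons (RtoC 0) (exp_coef (Cplus (RtoC s) w)) (S n)) -Hc.
  unfold Cdiv; ring.
Qed.

Lemma Re_shift_pos (w : C) (s : nat) : 0 < Re w -> 0 < Re (Cplus (RtoC (INR s)) w).
Proof. intros Hw. generalize (pos_INR s); unfold Re in *; simpl; lra. Qed.

Lemma period_integral (n : nat) (w : C) :
  0 < Re w -> exists I, improper (period_integrand n w 0) I /\
  forall s, (1 <= s)%nat ->
    I = Cplus (sum_n (fun k => log_integral n (Cplus (RtoC (INR k)) w)) (pred s))
          (reg_integral (S n) (bernoulli_gen w) (bernoulli_coef w) (INR s)).
Proof.
  intros Hw. assert (Hf := tame_bernoulli_gen w Hw).
  set (J := fun s => reg_integral (S n) (bernoulli_gen w) (bernoulli_coef w) (INR s)).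
  assert (HJ : forall s, improper (period_integrand n w (INR (S s))) (J (S s))).
  { intros s. apply improper_reg_quot_tame; [exact Hf|]. apply lt_0_INR; lia. }
  assert (Hstep : forall s v, improper (period_integrand n w (INR (S s))) v ->
    improper (period_integrand n w (INR s)) (Cplus v (log_integral n (Cplus (RtoC (INR s)) w)))).
  { intros s v Hv. assert (H := improper_plus _ _ _ _ Hv (improper_reg_quot_cexpm n _ (Re_shift_pos w s Hw))).
    apply improper_ext with (2 := H). intros t Ht.
    rewrite -(period_integrand_step n w (INR s) t Hw (pos_INR s) Ht) S_INR. ring. }
  (* The integral at [s = 0] is reached from [s = 1] by one step, because [improper_reg_quot_tame]
     requires [0 < s]. *)
  exists (Cplus (J 1%nat) (log_integral n (Cplus (RtoC (INR 0)) w))).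
  assert (H0 := Hstep O _ (HJ O)). split; [exact H0|].
  intros [|s] Hs; [lia|]. clear Hs. cbn [pred].
  induction s as [|s IH]; [rewrite csum_O -/(J 1%nat); ring|].
  rewrite IH csum_S -/(J (S (S s))) -/(J (S s)).
  rewrite (improper_unique _ _ _ (HJ s) (Hstep _ _ (HJ (S s)))). ring.
Qed.

(** Faulhaber's formula up to a factor: the power sum is a difference of values of one polynomial at
    0 and at the number of terms, and therefore has no constant term. *)
Lemma csum_exp_coef_shift (n : nat) (w : C) (s : nat) :
  0 < Re w ->
  sum_n (fun k => exp_coef (Cplus (RtoC (INR k)) w) n) s =
  Cminus (cauchy_prod (bernoulli_coef w) (exp_coef (RtoC 0)) (S n))
         (cauchy_prod (bernoulli_coef w) (exp_coef (RtoC (INR (S s)))) (S n)) :> C.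
Proof.
  intros Hw. induction s as [|s IH].
  - rewrite csum_O. assert (H := bernoulli_coef_step w 0 Hw (Rle_refl 0) (S n)).
    rewrite Rplus_0_l in H. exact (eq_sym H).
  - rewrite csum_S IH. assert (H := bernoulli_coef_step w (INR (S s)) Hw (pos_INR _) (S n)).
    rewrite -S_INR in H. cbn [seq_cons] in H. rewrite -H. ring.
Qed.

Lemma cauchy_prod_exp_coef_0 (a : nat -> C) (k : nat) : cauchy_prod a (exp_coef (RtoC 0)) k = a k.
Proof.
  revert a; induction k as [|k IH]; intros a.
  - cbn [cauchy_prod]. rewrite exp_coef_O; ring.
  - cbn [cauchy_prod]. rewrite IH exp_coef_S. unfold seq_tail. field. apply INR_S_neq.
Qed.

Definition stirling_factor (n : nat) : C := Cmult (Cpow (Copp (RtoC 1)) n) (RtoC (INR (fact n))).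

Lemma stirling_factor_exp_coef (n : nat) (z : C) : Cmult (stirling_factor n) (exp_coef z n) = Cpow z n.
Proof.
  unfold stirling_factor, exp_coef.
  replace z with (Cmult (Copp (RtoC 1)) (Copp z)) at 2 by ring. rewrite Cpow_mult_l.
  field. apply fact_neq.
Qed.

Lemma is_constant_term_partial_sum (n : nat) (w I : C) :
  0 < Re w ->
  (forall s, (1 <= s)%nat ->
    I = Cplus (sum_n (fun k => log_integral n (Cplus (RtoC (INR k)) w)) (pred s))
          (reg_integral (S n) (bernoulli_gen w) (bernoulli_coef w) (INR s))) ->
  is_constant_term (partial_sum n w) (Cmult (Copp (stirling_factor n)) I).
Proof.
  (* The Faulhaber polynomial has degree at most [n + 1], and [reg_integral] has order [n + 1]. *)
  intros Hw HI. set (M := S n). set (c := bernoulli_coef w).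
  assert (Hcst : forall x : C, has_constant_term M (fun _ => x) x).
  { intros x. assert (H := has_constant_term_scal _ x _ _ (has_constant_term_pow M 0 (Nat.le_0_l _))).
    rewrite -[X in has_constant_term _ _ X]Cmult_1_r.
    apply has_constant_term_ext with (2 := H). intros; simpl; ring. }
  (* The harmonic part contributes [c (S n) - c (S n) = 0] and the integral at [s] contributes 0, so
     [- I] alone survives. *)
  assert (H := has_constant_term_scal _ (stirling_factor n) _ _ (has_constant_term_plus _ _ _ _ _
    (has_constant_term_scal _ (RtoC (harmonic n)) _ _ (has_constant_term_plus _ _ _ _ _ (Hcst (c (S n)))
       (has_constant_term_scal _ (Copp (RtoC 1)) _ _ (has_constant_term_cauchy_prod M (S n) c (le_n _)))))
    (has_constant_term_plus _ _ _ _ _ (Hcst (Copp I))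
       (has_constant_term_reg_integral M (S n) _ _ (le_n _) (tame_bernoulli_gen w Hw))))).
  cut (has_constant_term M (partial_sum n w) (Cmult (Copp (stirling_factor n)) I)).
  { intros (a & b & Hab & Hb). exists M, a, b. split; [exact Hab | symmetry; exact Hb]. }
  replace (Cmult (Copp (stirling_factor n)) I) with
    (Cmult (stirling_factor n) (Cplus (Cmult (RtoC (harmonic n)) (Cplus (c (S n)) (Cmult (Copp (RtoC 1)) (c (S n)))))
      (Cplus (Copp I) (RtoC 0)))) by ring.
  apply has_constant_term_ext with (2 := H). clear H. intros [|s] Hs; [lia|].
  rewrite {1}(HI (S s) Hs). cbn [pred].
  rewrite -(cauchy_prod_exp_coef_0 c (S n)).
  replace (Cplus (cauchy_prod c (exp_coef (RtoC 0)) (S n)) (Cmult (Copp (RtoC 1)) (cauchy_prod c (exp_coef (RtoC (INR (S s)))) (S n))))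
    with (sum_n (fun k => exp_coef (Cplus (RtoC (INR k)) w) n) s : C) by (rewrite csum_exp_coef_shift //; unfold c; ring).
  unfold partial_sum. cbn [pred].
  rewrite (csum_ext (fun k => Cmult (Cpow _ _) _) (fun k => Cmult (stirling_factor n)
    (Cplus (Cmult (RtoC (harmonic n)) (exp_coef (Cplus (RtoC (INR k)) w) n))
       (Cmult (Copp (RtoC 1)) (log_integral n (Cplus (RtoC (INR k)) w)))))).
  - rewrite csum_scal csum_plus !csum_scal. ring.
  - intros k _. rewrite -stirling_factor_exp_coef. unfold log_integral. ring.
Qed.

(** The coefficients arise from [w] and rational numbers by field operations alone, since series
    division and product use nothing else. The two integrands need to agree only on the path of
    integration. *)
Lemma generated_period_integrand (n : nat) (w : C) :
  exists f : C -> C, generated_field (exp_generators w) f /\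
    forall t, 0 < t -> f (RtoC t) = Cmult (Copp (stirling_factor n)) (period_integrand n w 0 t).
Proof.
  set (G := exp_generators w).
  assert (Hz : generated_field G (fun z => z)) by (apply generated_gen, gen_t).
  assert (He : generated_field G (fun z => Cexp (Copp z))) by (apply generated_gen, gen_exp).
  assert (Hw : constant_in_field G w) by (apply (generated_gen G (fun _ => w)), gen_w).
  assert (He1 : forall t, 0 < t -> Cminus (RtoC 1) (Cexp (Copp (RtoC t))) <> RtoC 0).
  { intros t Ht. rewrite Cexp_opp_RtoC -RtoC_minus. apply RtoC_neq_0.
    generalize (one_minus_exp_pos t Ht); lra. }
  exists (fun z => Cmult (Copp (stirling_factor n)) (reg_quot (S n) (cauchy_prod (bernoulli_coef w) (exp_coef (RtoC 0))) z
    (Cdiv (Cexp (Copp (Cmult w z))) (Cdiv (Cminus (RtoC 1) (Cexp (Copp z))) z)))).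
  split.
  - apply (generated_mul G (fun _ => Copp (stirling_factor n))).
    + apply (generated_opp G (fun _ => stirling_factor n)).
      apply (generated_mul G (fun _ => Cpow (Copp (RtoC 1)) n)); [|apply constant_INR].
      apply constant_pow, (generated_opp G (fun _ => RtoC 1)), (constant_INR G 1).
    + apply generated_reg_quot; auto.
      * intros i. apply constant_cauchy_prod; intros j; [apply constant_cauchy_quot; intros k|].
        -- apply constant_exp_coef, Hw.
        -- apply (generated_opp G (fun _ => exp_coef (RtoC 1) (S k))), constant_exp_coef, (constant_INR G 1).
        -- apply constant_exp_coef, (constant_INR G 0).
      * apply generated_div.
        -- intros t Ht. apply Cmult_neq_0; [apply He1, Ht|].
           intros E. apply (C1_nz). rewrite -(Cinv_r (RtoC t)); [rewrite E; ring | apply RtoC_neq_0; lra].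
        -- apply generated_gen, gen_exp_w.
        -- apply generated_div; [intros t Ht; apply RtoC_neq_0; lra | | exact Hz].
           apply generated_minus; [apply (constant_INR G 1) | exact He].
  - intros t Ht. unfold period_integrand, bernoulli_gen, todd_denom. rewrite cexpm_0.
    do 2 f_equal. rewrite Cmult_1_r cexpm_RtoC Rmult_1_l Cexp_opp_RtoC. reflexivity.
Qed.

Theorem corollary1p2 (n : nat) (w : C) (hw : 0 < Re w) :
  exponential_period (generated_field (exp_generators w)) (stirling_ramanujan n w).
Proof.
  destruct (period_integral n w hw) as (I & HI & Hsum).
  assert (Hc := is_constant_term_partial_sum n w I hw Hsum).
  (* Existence makes the value chosen by [epsilon] a constant term, and uniqueness then identifies
     it. *)
  assert (E : stirling_ramanujan n w = Cmult (Copp (stirling_factor n)) I).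
  { apply (is_constant_term_unique (partial_sum n w)); [|exact Hc].
    exact (epsilon_spec (inhabits (RtoC 0)) _ (ex_intro _ _ Hc)). }
  destruct (generated_period_integrand n w) as (f & Hf & Hft).
  exists f. split; [exact Hf|]. rewrite E. apply improper_is_RInt_gen.
  apply improper_ext with (2 := improper_scal (Copp (stirling_factor n)) _ _ HI).
  intros t Ht. rewrite Hft //.
Qed.
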